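(* Each $N$-dimensional Frobenius manifold can be locally represented as a potential flat torsionless $N$-dimensional submanifold in a $2N$-dimensional pseudo-Euclidean space. (That is, every point of the Frobenius manifold has a neighbourhood which can be realized as such a submanifold so that the metric of the Frobenius manifold is the first fundamental form $g_{ij}$ and the multiplication on tangent spaces is $\frac{\partial}{\partial u^i}\circ\frac{\partial}{\partial u^j}=g^{ks}(\omega_i)_{sj}\frac{\partial}{\partial u^k}$, where $(\omega_i)_{sj}$ are the second fundamental forms.)
   Context: All objects are smooth; repeated upper and lower indices are summed. Frobenius manifold (Dubrovin): an $N$-dimensional pseudo-Riemannian manifold $M$ with metric $g$ and a multiplication $\circ$ on each tangent space $T_uM$ smoothly depending on $u$, such that: (1) $g(X\circ Y,Z)=g(X,Y\circ Z)$; (2) $X\circ Y=Y\circ X$; (3) $(X\circ Y)\circ Z=X\circ(Y\circ Z)$; (4) $g$ is flat; (5) for the symmetric tensor $A(X,Y,Z)=g(X\circ Y,Z)$, the tensor $(\nabla_WA)(X,Y,Z)$ is symmetric in $X,Y,Z,W$; (6) there is a unit vector field $U$ ($X\circ U=U\circ X=X$ for all $X$) with $\nabla U=0$; (7) there is a vector field $E$ with $\nabla\nabla E=0$, $\mathcal L_E(X\circ Y)-(\mathcal L_EX)\circ Y-X\circ(\mathcal L_EY)=X\circ Y$, $\mathcal L_E\,g(X,Y)-g(\mathcal L_EX,Y)-g(X,\mathcal L_EY)=K\,g(X,Y)$ for a fixed constant $K$, and $\mathcal L_EU=-U$. Here $\nabla$ is the Levi-Civita connection of $g$ and $\mathcal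 L_E$ the Lie derivative. A pseudo-Euclidean space is a real vector space with a constant nondegenerate symmetric bilinear form $(\cdot,\cdot)$ of arbitrary signature. Submanifolds $r(u^1,\dots,u^N)$ are totally nonisotropic: the first fundamental form $g_{ij}=(r_{u^i},r_{u^j})$ is nondegenerate (inverse $g^{ij}$); flat means $g_{ij}$ is a flat metric. Normal bases $n_\alpha$ with constant nondegenerate Gram matrix are used; second fundamental forms: $(\omega_\alpha)_{ij}=(n_\alpha,r_{u^iu^j})$; torsionless means that for a suitable such basis (the one used) the torsion forms $(n_{\alpha,u^i},n_\beta)\,du^i$ all vanish. A flat torsionless $N$-dimensional submanifold in a $2N$-dimensional pseudo-Euclidean space is potential if there always locally exists a function $\Phi(u)$ such that $(\omega_i)_{jk}=\nabla_i\nabla_j\nabla_k\Phi$, $1\le i\le N$, with $\nabla$ the Levi-Civita covariant differentiation of $g_{ij}$. *)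

(* Defs.v *)
From HB Require Import structures.
From mathcomp Require Import all_boot all_order all_algebra.
From mathcomp Require Import boolp classical_sets functions cardinality reals.
From mathcomp Require Import topology normedtype derive.

Set Implicit Arguments.
Unset Strict Implicit.
Unset Printing Implicit Defensive.

Import Order.TTheory GRing.Theory Num.Theory.
Import numFieldNormedType.Exports.

Local Open Scope classical_set_scope.
Local Open Scope ring_scope.

Section Calculus.
Context {R : realType} {N : nat} {W : normedModType R}.

Definition ebase (i : 'I_N) : 'rV[R]_N := delta_mx 0 i.

Definition pd (i : 'I_N) (f : 'rV[R]_N -> W) (x : 'rV[R]_N) : W :=
  'D_(ebase i) f x.

(* C^oo on D (only used for open D): all iterated partial derivatives exist
   and are continuous at the points of D. *)
Definition smooth_on (D : set 'rV[R]_N) (f : 'rV[R]_N -> W) : Prop :=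
  forall (s : seq 'I_N) (x : 'rV[R]_N), D x ->
    {for x, continuous (foldr pd f s)} /\
    (forall i : 'I_N, derivable (foldr pd f s) x (ebase i)).

End Calculus.

Section Manifolds.
Context {R : realType} {N : nat}.

(* chart_map and chart_inv are total functions; their values outside chart_dom
   and chart_cod are irrelevant. *)
Record chart (M : topologicalType) := Chart {
  chart_dom : set M;
  chart_cod : set 'rV[R]_N;
  chart_map : M -> 'rV[R]_N;
  chart_inv : 'rV[R]_N -> M;
  chart_dom_open : open chart_dom;
  chart_cod_open : open chart_cod;
  chart_map_in : forall p, chart_dom p -> chart_cod (chart_map p);
  chart_inv_in : forall x, chart_cod x -> chart_dom (chart_inv x);
  chart_mapK : forall p, chart_dom p -> chart_inv (chart_map p) = p;
  chart_invK : forall x, chart_cod x -> chart_map (chart_inv x) = x;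
  chart_map_cts : forall p, chart_dom p -> {for p, continuous chart_map};
  chart_inv_cts : forall x, chart_cod x -> {for x, continuous chart_inv} }.

Definition transition (M : topologicalType) (a b : chart M) (x : 'rV[R]_N) :
  'rV[R]_N := chart_map b (chart_inv a x).

(* The part of the codomain of a on which [transition a b] is meaningful. *)
Definition overlap (M : topologicalType) (a b : chart M) : set 'rV[R]_N :=
  [set x | chart_cod a x /\ chart_dom b (chart_inv a x)].

Definition compatible (M : topologicalType) (a b : chart M) : Prop :=
  smooth_on (overlap a b) (transition a b) /\
  smooth_on (overlap b a) (transition b a).

Record smoothManifold := SmoothManifold {
  carrier :> topologicalType;
  carrier_hausdorff : hausdorff_space carrier;
  carrier_second_countable : @second_countable carrier;
  atlas : set (chart carrier);
  atlas_cover : forall p : carrier, exists2 a, atlas a & chart_dom a p;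
  atlas_compatible : forall a b, atlas a -> atlas b -> compatible a b;
  atlas_maximal : forall a, (forall b, atlas b -> compatible a b) -> atlas a }.

(* The components in b of the tangent vector that has components X at x in a. *)
Definition change_chart (M : topologicalType) (a b : chart M)
  (x X : 'rV[R]_N) : 'rV[R]_N := 'D_X (transition a b) x.

End Manifolds.

Arguments chart R N M : clear implicits.
Arguments smoothManifold R N : clear implicits.

(* In coordinates, a tangent vector is the row of its components, a metric is
   a function of the point with values in 'M_N, and a multiplication on tangent
   spaces is an operation mul x X Y on rows depending on the point x. *)

Section LocalGeometry.
Context {R : realType} {N : nat}.
Implicit Types (x X Y Z : 'rV[R]_N) (i j k l m : 'I_N).

Definition bilin (n : nat) (Q : 'M[R]_n) (v w : 'rV[R]_n) : R :=
  (v *m Q *m w^T) 0 0.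

(* Gamma^k_ij *)
Definition christoffel (g : 'rV[R]_N -> 'M[R]_N) k i j x : R :=
  2^-1 * \sum_l invmx (g x) k l *
    (pd i g x l j + pd j g x l i - pd l g x i j).

(* R^l_kij, i.e. the components of (nabla_i nabla_j - nabla_j nabla_i) d_k *)
Definition riemann (g : 'rV[R]_N -> 'M[R]_N) l k i j x : R :=
  pd i (christoffel g l j k) x - pd j (christoffel g l i k) x
  + \sum_m (christoffel g l i m x * christoffel g m j k x
            - christoffel g l j m x * christoffel g m i k x).

Definition flat_metric (D : set 'rV[R]_N) (g : 'rV[R]_N -> 'M[R]_N) : Prop :=
  forall x, D x -> forall l k i j, riemann g l k i j x = 0.

(* Levi-Civita covariant derivative, the first index being the direction of
   differentiation: covariant tensors of rank 1, 2, 3, then tensors with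
   components X^k and T_i^k. *)
Definition nabla_cov1 g (t : 'I_N -> 'rV[R]_N -> R) i j x : R :=
  pd i (t j) x - \sum_m christoffel g m i j x * t m x.

Definition nabla_cov2 g (t : 'I_N -> 'I_N -> 'rV[R]_N -> R) i j k x : R :=
  pd i (t j k) x
  - \sum_m christoffel g m i j x * t m k x
  - \sum_m christoffel g m i k x * t j m x.

Definition nabla_cov3 g (t : 'I_N -> 'I_N -> 'I_N -> 'rV[R]_N -> R)
    i j k l x : R :=
  pd i (t j k l) x
  - \sum_m christoffel g m i j x * t m k l x
  - \sum_m christoffel g m i k x * t j m l x
  - \sum_m christoffel g m i l x * t j k m x.

Definition nabla_vect g (X : 'rV[R]_N -> 'rV[R]_N) i k x : R :=
  pd i X x 0 k + \sum_m christoffel g k i m x * X x 0 m.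

Definition nabla_mixed g (T : 'I_N -> 'I_N -> 'rV[R]_N -> R) l i k x : R :=
  pd l (T i k) x
  - \sum_m christoffel g m l i x * T m k x
  + \sum_m christoffel g k l m x * T i m x.

Definition third_cov_deriv g (Phi : 'rV[R]_N -> R) i j k x : R :=
  nabla_cov2 g (nabla_cov1 g (fun c => pd c Phi)) i j k x.

(* L_E X = [E, X] *)
Definition lie_vect (E X : 'rV[R]_N -> 'rV[R]_N) x : 'rV[R]_N :=
  'D_(E x) X x - 'D_(X x) E x.

Definition lie_fun (E : 'rV[R]_N -> 'rV[R]_N) (f : 'rV[R]_N -> R) x : R :=
  'D_(E x) f x.

(* A_ijk = g(d_i o d_j, d_k) *)
Definition A_tensor (g : 'rV[R]_N -> 'M[R]_N)
    (mul : 'rV[R]_N -> 'rV[R]_N -> 'rV[R]_N -> 'rV[R]_N) i j k x : R :=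
  bilin (g x) (mul x (ebase i) (ebase j)) (ebase k).

Record frobenius_on (D : set 'rV[R]_N) (g : 'rV[R]_N -> 'M[R]_N)
    (mul : 'rV[R]_N -> 'rV[R]_N -> 'rV[R]_N -> 'rV[R]_N)
    (U E : 'rV[R]_N -> 'rV[R]_N) (K : R) : Prop := FrobeniusOn {
  fr_metric_smooth : smooth_on D g;
  fr_metric_sym : forall x, D x -> (g x)^T = g x;
  fr_metric_nondegenerate : forall x, D x -> g x \in unitmx;
  fr_mul_linearl : forall x, D x -> forall (c : R) X Y Z,
    mul x (c *: X + Y) Z = c *: mul x X Z + mul x Y Z;
  fr_mul_linearr : forall x, D x -> forall (c : R) X Y Z,
    mul x X (c *: Y + Z) = c *: mul x X Y + mul x X Z;
  fr_mul_smooth : forall i j, smooth_on D (fun x => mul x (ebase i) (ebase j));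
  fr_mul_invariant : forall x, D x -> forall X Y Z,
    bilin (g x) (mul x X Y) Z = bilin (g x) X (mul x Y Z);
  fr_mulC : forall x, D x -> forall X Y, mul x X Y = mul x Y X;
  fr_mulA : forall x, D x -> forall X Y Z,
    mul x (mul x X Y) Z = mul x X (mul x Y Z);
  fr_flat : flat_metric D g;
  (* symmetry under the three adjacent transpositions of the four indices *)
  fr_nablaA_sym : forall x, D x -> forall l i j k,
    let nA := nabla_cov3 g (A_tensor g mul) in
    [/\ nA l i j k x = nA i l j k x,
        nA l i j k x = nA l j i k x &
        nA l i j k x = nA l i k j x];
  fr_unit_smooth : smooth_on D U;
  fr_unit : forall x, D x -> forall X, mul x X (U x) = X /\ mul x (U x) X = X;
  fr_unit_parallel : forall x, D x -> forall i k, nabla_vect g U i k x = 0;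
  fr_euler_smooth : smooth_on D E;
  fr_euler_affine : forall x, D x -> forall l i k,
    nabla_mixed g (nabla_vect g E) l i k x = 0;
  fr_euler_mul : forall X Y : 'rV[R]_N -> 'rV[R]_N,
    smooth_on D X -> smooth_on D Y -> forall x, D x ->
    lie_vect E (fun y => mul y (X y) (Y y)) x
    - mul x (lie_vect E X x) (Y x) - mul x (X x) (lie_vect E Y x)
    = mul x (X x) (Y x);
  fr_euler_metric : forall X Y : 'rV[R]_N -> 'rV[R]_N,
    smooth_on D X -> smooth_on D Y -> forall x, D x ->
    lie_fun E (fun y => bilin (g y) (X y) (Y y)) x
    - bilin (g x) (lie_vect E X x) (Y x) - bilin (g x) (X x) (lie_vect E Y x)
    = K * bilin (g x) (X x) (Y x);
  fr_euler_unit : forall x, D x -> lie_vect E U x = - U x }.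

End LocalGeometry.

(* Tensor fields on M are families of components, one for each chart of the
   (maximal) atlas, obeying the tensor transformation law on overlaps. *)
Record frobeniusManifold (R : realType) (N : nat) := FrobeniusManifold {
  fmanifold :> smoothManifold R N;
  fmetric : chart R N fmanifold -> 'rV[R]_N -> 'M[R]_N;
  fmul : chart R N fmanifold -> 'rV[R]_N -> 'rV[R]_N -> 'rV[R]_N -> 'rV[R]_N;
  funit : chart R N fmanifold -> 'rV[R]_N -> 'rV[R]_N;
  feuler : chart R N fmanifold -> 'rV[R]_N -> 'rV[R]_N;
  fconst : R;
  fmetric_tensor : forall a b, atlas a -> atlas b ->
    forall x, overlap a b x -> forall X Y,
    bilin (fmetric a x) X Y =
    bilin (fmetric b (transition a b x))
          (change_chart a b x X) (change_chart a b x Y);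
  fmul_tensor : forall a b, atlas a -> atlas b ->
    forall x, overlap a b x -> forall X Y,
    change_chart a b x (fmul a x X Y) =
    fmul b (transition a b x) (change_chart a b x X) (change_chart a b x Y);
  funit_tensor : forall a b, atlas a -> atlas b ->
    forall x, overlap a b x ->
    change_chart a b x (funit a x) = funit b (transition a b x);
  feuler_tensor : forall a b, atlas a -> atlas b ->
    forall x, overlap a b x ->
    change_chart a b x (feuler a x) = feuler b (transition a b x);
  fmanifoldP : forall a, atlas a ->
    frobenius_on (chart_cod a) (fmetric a) (fmul a) (funit a) (feuler a)
                 fconst }.

Section Submanifolds.
Context {R : realType} {N d : nat}.
Implicit Types (D : set 'rV[R]_N) (Q : 'M[R]_d) (r : 'rV[R]_N -> 'rV[R]_d)
  (n : 'I_N -> 'rV[R]_N -> 'rV[R]_d).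

(* Q is the Gram matrix of the scalar product of the ambient space R^d. *)
Definition pseudo_euclidean Q : Prop := Q^T = Q /\ Q \in unitmx.

Definition first_form Q r (x : 'rV[R]_N) : 'M[R]_N :=
  \matrix_(i, j) bilin Q (pd i r x) (pd j r x).

(* (omega_a)_jk *)
Definition second_form Q r n (a j k : 'I_N) (x : 'rV[R]_N) : R :=
  bilin Q (n a x) (pd j (pd k r) x).

(* r is a homeomorphism of D onto its image, with inverse q. *)
Definition embedding D r : Prop :=
  exists q : 'rV[R]_d -> 'rV[R]_N,
    {within r @` D, continuous q} /\ (forall x, D x -> q (r x) = x).

Definition torsionless_frame D Q r n : Prop :=
  [/\ forall a, smooth_on D (n a),
      forall x, D x -> forall a i, bilin Q (n a x) (pd i r x) = 0,
      exists2 mu : 'M[R]_N, mu \in unitmx &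
        forall x, D x -> forall a b, bilin Q (n a x) (n b x) = mu a b &
      forall x, D x -> forall a b i, bilin Q (pd i (n a) x) (n b x) = 0].

End Submanifolds.

(* N normal vectors with nondegenerate Gram matrix form a basis of the normal
   space because the ambient dimension is 2N. *)
Definition flat_torsionless_submanifold (R : realType) (N : nat)
    (D : set 'rV[R]_N) (Q : 'M[R]_(2 * N)) (r : 'rV[R]_N -> 'rV[R]_(2 * N))
    (n : 'I_N -> 'rV[R]_N -> 'rV[R]_(2 * N)) : Prop :=
  [/\ open D,
      smooth_on D r /\ embedding D r,
      forall x, D x -> first_form Q r x \in unitmx,
      flat_metric D (first_form Q r) &
      torsionless_frame D Q r n].

Definition potential_submanifold (R : realType) (N : nat)
    (D : set 'rV[R]_N) (Q : 'M[R]_(2 * N)) (r : 'rV[R]_N -> 'rV[R]_(2 * N))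
    (n : 'I_N -> 'rV[R]_N -> 'rV[R]_(2 * N)) : Prop :=
  flat_torsionless_submanifold D Q r n /\
  forall x, D x -> exists (V : set 'rV[R]_N) (Phi : 'rV[R]_N -> R),
    [/\ open V, V x, V `<=` D, smooth_on V Phi &
        forall y, V y -> forall i j k : 'I_N,
          second_form Q r n i j k y =
          third_cov_deriv (first_form Q r) Phi i j k y].

(* Main.v *)
(* In flat coordinates the metric is a constant matrix eta, the matrices C_i of
   multiplication by the coordinate fields commute, d_i C_j = d_j C_i, and the
   C_i eta form a totally symmetric tensor, hence consist of the third derivatives
   of a potential.  Therefore the linear system d_i F = B_i F, where the blocks of
   B_i are 0, - C_i, - C_i, 0, is integrable, and it preserves the scalar product
   diag(eta, - eta).  The first N rows of the solution F with F = 1 at the base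
   point are the derivatives of an immersion r; its other N rows are the
   torsionless normals.  Near the base point the first N components of r are close
   to the identity up to a constant, so that r is an embedding.

   The flat coordinates come from the same kind of system: flatness makes the
   equation d_i psi_j = Gamma^k_ij psi_k of parallel covectors integrable, and the
   parallel covectors are closed.  Integrable linear systems are solved by Picard
   iteration along the rays issued from the base point.  Smoothness of solutions
   and of local inverses follows by bootstrapping from the equation they satisfy. *)

Require Import Defs.
From HB Require Import structures.
From mathcomp Require Import all_boot all_order all_algebra.
From mathcomp Require Import ring lra.
From mathcomp Require Import boolp classical_sets functions cardinality reals ereal.
From mathcomp Require Import topology normedtype derive set_interval landau realfun.
From mathcomp Require Import measure lebesgue_measure lebesgue_integral ftc.
Import Order.TTheory GRing.Theory Num.Theory.
Import numFieldNormedType.Exports.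
Local Open Scope classical_set_scope.
Local Open Scope ring_scope.

Set Implicit Arguments.
Unset Strict Implicit.
Unset Printing Implicit Defensive.

(** * Smooth functions *)

Lemma is_derivable (R : numFieldType) (V W : normedModType R) (f : V -> W) x v df :
  is_derive x v f df -> derivable f x v.
Proof. by case. Qed.

Lemma is_deriveE (R : numFieldType) (V W : normedModType R) (f : V -> W) x v df :
  is_derive x v f df -> 'D_v f x = df.
Proof. by case. Qed.

Section SmoothFunctions.
Context {R : realType} {N : nat} {W : normedModType R}.
Implicit Types (D : set 'rV[R]_N) (f g : 'rV[R]_N -> W).

Lemma open_near D x (P : 'rV[R]_N -> Prop) :
  open D -> D x -> (forall y, D y -> P y) -> \near x, P x.
Proof.
move=> oD Dx DP; apply: filterS DP _; exact: open_nbhs_nbhs.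
Qed.

Lemma pd_eq D f g i x :
  open D -> (forall y, D y -> f y = g y) -> D x -> pd i f x = pd i g x.
Proof. by move=> oD fg Dx; apply: near_eq_derive; exact: (open_near oD Dx fg). Qed.

Lemma derivable_eq D f g v x :
  open D -> (forall y, D y -> f y = g y) -> D x ->
  derivable f x v -> derivable g x v.
Proof. by move=> oD fg Dx; exact: near_eq_derivable (open_near oD Dx fg). Qed.

Lemma continuous_eq D f g x :
  open D -> (forall y, D y -> f y = g y) -> D x ->
  {for x, continuous f} -> {for x, continuous g}.
Proof.
move=> oD fg Dx cf; rewrite /prop_for /continuous_at -(fg x Dx).
have H : \near x, f x = g x by exact: (open_near oD Dx fg).
by apply: cvg_trans cf; exact: near_eq_cvg H.
Qed.

Fixpoint Cn (n : nat) D f : Prop :=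
  (forall x, D x -> {for x, continuous f}) /\
  if n is n'.+1 then
    forall i, (forall x, D x -> derivable f x (ebase i)) /\ Cn n' D (pd i f)
  else True.

Lemma Cn_continuous n D f x : Cn n D f -> D x -> {for x, continuous f}.
Proof. by case: n => [|n] [cf _]; apply: cf. Qed.

Lemma Cn_derivable n D f i x : Cn n.+1 D f -> D x -> derivable f x (ebase i).
Proof. by move=> [_ /(_ i)[df _]]; apply: df. Qed.

Lemma Cn_pd n D f i : Cn n.+1 D f -> Cn n D (pd i f).
Proof. by move=> [_ /(_ i)[]]. Qed.

Lemma Cn_pred n D f : Cn n.+1 D f -> Cn n D f.
Proof.
elim: n f => [|n IH] f [cf df]; split=> // i.
by split; [exact: (df i).1|exact: IH (df i).2].
Qed.

Lemma Cn_sub n D D' f : D' `<=` D -> Cn n D f -> Cn n D' f.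
Proof.
move=> D'D; elim: n f => [|n IH] f [cf df]; (split; first by move=> x /D'D; exact: cf) => // i.
by split; [move=> x /D'D; exact: (df i).1|exact: IH (df i).2].
Qed.

Lemma Cn_eq n D f g : open D -> (forall x, D x -> f x = g x) ->
  Cn n D f -> Cn n D g.
Proof.
move=> oD; elim: n f g => [|n IH] f g fg [cf df];
  (split; first by move=> x Dx; exact: continuous_eq fg Dx (cf x Dx)) => // i.
split=> [x Dx|]; first exact: derivable_eq fg Dx ((df i).1 x Dx).
by apply: IH (df i).2 => x Dx; exact: pd_eq fg Dx.
Qed.

Lemma smooth_onP D f : smooth_on D f <-> forall n, Cn n D f.
Proof.
split=> [sf n|Cf].
  elim: n f sf => [|n IH] f sf;
    (split; first by move=> x Dx; exact: (sf [::] x Dx).1) => // i.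
  split=> [x Dx|]; first exact: (sf [::] x Dx).2.
  by apply: IH => s x Dx; have := sf (rcons s i) x Dx; rewrite foldr_rcons.
move=> s; elim/last_ind: s f Cf => [|s i IH] f Cf x Dx.
  split; first exact: Cn_continuous (Cf 0%N) Dx.
  by move=> i; exact: Cn_derivable (Cf 1%N) Dx.
by rewrite foldr_rcons; apply: IH => // n; exact: Cn_pd (Cf n.+1).
Qed.

Lemma smooth_pd D f i : smooth_on D f -> smooth_on D (pd i f).
Proof.
by move=> /smooth_onP sf; apply/smooth_onP => n; exact: Cn_pd (sf n.+1).
Qed.

Lemma smooth_sub D D' f : D' `<=` D -> smooth_on D f -> smooth_on D' f.
Proof.
by move=> DD /smooth_onP sf; apply/smooth_onP => n; exact: Cn_sub (sf n).
Qed.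

Lemma smooth_eq D f g : open D -> (forall x, D x -> f x = g x) ->
  smooth_on D f -> smooth_on D g.
Proof.
move=> oD fg /smooth_onP sf; apply/smooth_onP => n; exact: Cn_eq (sf n).
Qed.

Lemma smooth_continuous D f x : smooth_on D f -> D x -> {for x, continuous f}.
Proof. by move=> sf Dx; exact: (sf [::] x Dx).1. Qed.

Lemma smooth_derivable D f x i : smooth_on D f -> D x ->
  derivable f x (ebase i).
Proof. by move=> sf Dx; exact: (sf [::] x Dx).2. Qed.

Lemma pd_cst (c : W) i : pd i (fun _ : 'rV[R]_N => c) = fun=> 0.
Proof. by apply/funext => x; rewrite /pd derive_cst. Qed.

Lemma Cn_cst n D (c : W) : Cn n D (fun=> c).
Proof.
elim: n c => [|n IH] c; (split; first by move=> x _; exact: cst_continuous) => // i.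
by split; [move=> x _; exact: derivable_cst|rewrite pd_cst; exact: IH].
Qed.

Lemma Cn_add n D f g : open D ->
  Cn n D f -> Cn n D g -> Cn n D (fun x => f x + g x).
Proof.
move=> oD; elim: n f g => [|n IH] f g [cf df] [cg dg];
  (split; first by move=> x Dx; exact: continuousD (cf x Dx) (cg x Dx)) => // i.
split=> [x Dx|]; first by exact: derivableD ((df i).1 x Dx) ((dg i).1 x Dx).
apply: (@Cn_eq _ _ (fun x => pd i f x + pd i g x)) => //.
    by move=> x Dx; rewrite /pd -deriveD//; [exact: (df i).1|exact: (dg i).1].
  by apply: IH; [exact: (df i).2|exact: (dg i).2].
Qed.

Lemma smooth_cst D (c : W) : smooth_on D (fun=> c).
Proof. by apply/smooth_onP => n; exact: Cn_cst. Qed.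

End SmoothFunctions.

Section RealValued.
Context {R : realType} {N : nat}.
Implicit Types (D : set 'rV[R]_N) (f g : 'rV[R]_N -> R).

Lemma pdM f g i x : derivable f x (ebase i) -> derivable g x (ebase i) ->
  pd i (fun y => f y * g y) x = f x * pd i g x + pd i f x * g x.
Proof.
by move=> df dg; rewrite /pd [LHS](deriveM df dg) /GRing.scale/= [g x * _]mulrC.
Qed.

Lemma Cn_mul n D f g : open D ->
  Cn n D f -> Cn n D g -> Cn n D (fun x => f x * g x).
Proof.
move=> oD; elim: n f g => [|n IH] f g Cf Cg; move: (Cf) (Cg) => [cf df] [cg dg];
  (split; first by move=> x Dx; exact: continuousM (cf x Dx) (cg x Dx)) => // i.
split=> [x Dx|]; first by exact: derivableM ((df i).1 x Dx) ((dg i).1 x Dx).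
apply: (@Cn_eq _ _ _ _ _ (fun x => f x * pd i g x + pd i f x * g x)) => //.
    by move=> x Dx; rewrite pdM//; [exact: (df i).1|exact: (dg i).1].
  apply: Cn_add => //; apply: IH => //; try exact: Cn_pred.
    exact: (dg i).2.
  exact: (df i).2.
Qed.

Lemma Cn_sum n D (I : Type) (r : seq I) (P : pred I) (F : I -> 'rV[R]_N -> R) :
  open D -> (forall i, P i -> Cn n D (F i)) ->
  Cn n D (fun x => \sum_(i <- r | P i) F i x).
Proof.
move=> oD CF; elim: r => [|i r IH].
  by under eq_fun do rewrite big_nil; exact: Cn_cst.
case Pi: (P i); last by under eq_fun do rewrite big_cons Pi.
by under eq_fun do rewrite big_cons Pi; apply: Cn_add => //; exact: CF.
Qed.

Lemma is_derive_sumr (V : normedModType R) (I : Type) (r : seq I) (P : pred I)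
    (F : I -> V -> R) (dF : I -> R) x v :
  (forall i, P i -> is_derive x v (F i) (dF i)) ->
  is_derive x v (fun y => \sum_(i <- r | P i) F i y) (\sum_(i <- r | P i) dF i).
Proof.
move=> HF; elim: r => [|i r IH].
  by rewrite big_nil; under eq_fun do rewrite big_nil; exact: is_derive_cst.
rewrite big_cons; case Pi: (P i); last by under eq_fun do rewrite big_cons Pi.
by under eq_fun do rewrite big_cons Pi; apply: is_deriveD => //; exact: HF.
Qed.

Lemma pd_sum (I : Type) (r : seq I) (P : pred I) (F : I -> 'rV[R]_N -> R) i x :
  (forall j, P j -> derivable (F j) x (ebase i)) ->
  pd i (fun y => \sum_(j <- r | P j) F j y) x = \sum_(j <- r | P j) pd i (F j) x.
Proof.
move=> dF; have H j : P j -> is_derive x (ebase i) (F j) (pd i (F j) x).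
  by move=> Pj; exact/derivableP/dF.
exact: is_deriveE (is_derive_sumr r H).
Qed.

Lemma is_derive_coord m n (x v : 'M[R]_(m, n)) i j :
  is_derive x v (fun y : 'M[R]_(m, n) => y i j) (v i j).
Proof.
split; first exact/diff_derivable/differentiable_coord.
rewrite deriveE; last exact: differentiable_coord.
have H : linear (fun M : 'M[R]_(m, n) => M i j : R^o) by move=> ? ? ?; rewrite !mxE.
pose l := GRing.isLinear.Build _ _ _ _ _ H.
pose L : {linear 'M[R]_(m, n) -> R^o} := HB.pack (fun M : 'M[R]_(m, n) => M i j : R^o) l.
by rewrite -[LHS]/('d L x v) diff_lin//; exact: coord_continuous.
Qed.

Lemma pd_coord (i j : 'I_N) x : pd i (fun y : 'rV[R]_N => y 0 j) x = (i == j)%:R.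
Proof.
rewrite /pd (is_deriveE (is_derive_coord _ _ _ _)).
by rewrite /ebase mxE eqxx/= eq_sym.
Qed.

Lemma Cn_coord n D j : Cn n D (fun y : 'rV[R]_N => y 0 j).
Proof.
case: n => [|n]; (split; first by move=> x _; exact: coord_continuous) => // i.
split; first by move=> x _; exact/diff_derivable/differentiable_coord.
have -> : pd i (fun y : 'rV[R]_N => y 0 j) = fun=> (i == j)%:R :> R.
  by apply/funext => x; exact: pd_coord.
exact: Cn_cst.
Qed.

End RealValued.

Section MatrixValued.
Context {R : realType} {N : nat}.
Implicit Types (D : set 'rV[R]_N).

Lemma continuous_mxP (T : topologicalType) m n (F : T -> 'M[R]_(m, n)) (x : T) :
  {for x, continuous F} <-> forall i j, {for x, continuous (fun y => F y i j)}.
Proof.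
split=> [cF i j|cF].
  exact: (@cvg_comp _ _ _ F (fun M : 'M[R]_(m, n) => M i j) _ _ _ cF
    (@coord_continuous _ _ _ i j _)).
apply/cvgrPdist_le => /= e e0; near=> y.
rewrite /Num.Def.normr/= mx_normrE (bigmax_le _ (ltW e0))//= => i _.
rewrite !mxE; move: i; near: y; apply: filter_forall => /= i.
exact: ((cvgrPdist_le _ _).1 (cF i.1 i.2)).
Unshelve. all: by end_near. Qed.

Lemma pd_mxE m n (F : 'rV[R]_N -> 'M[R]_(m, n)) k x i j :
  derivable F x (ebase k) -> pd k F x i j = pd k (fun y => F y i j) x.
Proof. by move=> dF; rewrite /pd derive_mx// mxE. Qed.

Lemma Cn_mxP n D m p (F : 'rV[R]_N -> 'M[R]_(m, p)) : open D ->
  Cn n D F <-> forall i j, Cn n D (fun y => F y i j).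
Proof.
move=> oD; elim: n F => [|n IH] F.
  split=> [[cF _] i j|CF].
    by split=> // x Dx; move: i j; apply/continuous_mxP/cF.
  by split=> // x Dx; apply/continuous_mxP => i j; exact: (CF i j).1.
split=> [[cF dF] i j|CF].
  split=> [x Dx|k]; first by move: i j; apply/continuous_mxP/cF.
  have [dFk CFk] := dF k; split=> [x Dx|].
    by move: i j; apply/derivable_mxP/dFk.
  apply: (Cn_eq oD _ ((IH _).1 CFk i j)) => x Dx.
  by rewrite pd_mxE//; exact: dFk.
split=> [x Dx|k]; first by apply/continuous_mxP => i j; exact: (CF i j).1.
have dF x : D x -> derivable F x (ebase k).
    by move=> Dx; apply/derivable_mxP => i j; exact: ((CF i j).2 k).1.
  split=> //; apply/IH => i j.
  apply: (Cn_eq oD _ ((CF i j).2 k).2) => x Dx.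
  by rewrite pd_mxE//; exact: dF.
Qed.

Lemma smooth_mxP D m p (F : 'rV[R]_N -> 'M[R]_(m, p)) : open D ->
  smooth_on D F <-> forall i j, smooth_on D (fun y => F y i j).
Proof.
move=> oD; split=> [/smooth_onP sF i j|sF].
  by apply/smooth_onP => n; move: i j; apply/Cn_mxP.
by apply/smooth_onP => n; apply/Cn_mxP => // i j; exact: (smooth_onP _ _).1.
Qed.

Lemma Cn_mulmx n D m p q (F : 'rV[R]_N -> 'M[R]_(m, p))
    (G : 'rV[R]_N -> 'M[R]_(p, q)) : open D ->
  Cn n D F -> Cn n D G -> Cn n D (fun x => F x *m G x).
Proof.
move=> oD CF CG; apply/Cn_mxP => // i j.
under eq_fun do rewrite mxE.
by apply: Cn_sum => // k _; apply: Cn_mul => //; [move: i k|move: k j]; apply/Cn_mxP.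
Qed.

Lemma derivable_mulmx m p q (F : 'rV[R]_N -> 'M[R]_(m, p))
    (G : 'rV[R]_N -> 'M[R]_(p, q)) k x :
  derivable F x (ebase k) -> derivable G x (ebase k) ->
  is_derive x (ebase k) (fun y => F y *m G y) (pd k F x *m G x + F x *m pd k G x).
Proof.
move=> dF dG.
have H i j : is_derive x (ebase k) (fun y => (F y *m G y) i j)
    ((pd k F x *m G x + F x *m pd k G x) i j).
  under [X in is_derive _ _ X _]eq_fun do rewrite mxE.
  rewrite !mxE -big_split/=; apply: is_derive_sumr => l _.
  have dFil : derivable (fun y => F y i l) x (ebase k) by exact: (derivable_mxP _ _ _).1.
  have dGlj : derivable (fun y => G y l j) x (ebase k) by exact: (derivable_mxP _ _ _).1.
  apply: DeriveDef; first exact: derivableM.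
  by rewrite [LHS]pdM// !pd_mxE// addrC.
have dFG : derivable (fun y => F y *m G y) x (ebase k).
  by apply/derivable_mxP => i j; exact: (is_derivable (H i j)).
apply: DeriveDef => //; rewrite derive_mx//.
by apply/matrixP => i j; rewrite mxE (is_deriveE (H i j)).
Qed.

End MatrixValued.

(** * Mean value inequalities and the chain rule *)

Lemma is_diff_near (R : numFieldType) (V W : normedModType R) (f : V -> W)
    (df : {linear V -> W}) (x : V) : continuous df ->
  (forall e : R, 0 < e -> \forall y \near x, `|f y - f x - df (y - x)| <= e * `|y - x|) ->
  is_diff x f df.
Proof.
move=> cdf H.
have E : f \o shift x = cst (f x) + df +o_ 0 id.
  apply/eqaddoP => e e0; near=> y; rewrite /= !fctE opprD addrA.
  have {2 3}-> : y = (y + x) - x by rewrite addrK.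
  near: y; have := H e e0; rewrite (near_shift 0 x)/= subr0.
  exact.
have D := diff_unique cdf E.
by apply: DiffDef => //; apply/diff_locallyP; rewrite D.
Unshelve. all: by end_near. Qed.

Section MeanValue.
Context {R : realType}.

Lemma growth_line (V W : normedModType R) (f : V -> W) (x v : V) (s : R) :
  (fun h : R => h^-1 *: (f (x + (h *: 1 + s) *: v) - f (x + s *: v))) =
  (fun h : R => h^-1 *: (f (h *: v + (x + s *: v)) - f (x + s *: v))).
Proof.
apply/funext => h; congr (_ *: (f _ - _)).
by rewrite [h *: 1]mulr1 scalerDl addrCA.
Qed.

Lemma is_derive_line (V W : normedModType R) (f : V -> W) (x v : V) (s : R) :
  derivable f (x + s *: v) v ->
  is_derive s 1 (fun s => f (x + s *: v)) ('D_v f (x + s *: v)).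
Proof.
move=> df; split; last by rewrite /derive/= growth_line.
by rewrite /derivable/= growth_line.
Qed.

Lemma dir_mvt (V : normedModType R) (f : V -> R) (x v : V) (a c e : R) :
  (forall t : R, 0 <= t <= 1 -> derivable f (x + (t * a) *: v) v /\
    `|'D_v f (x + (t * a) *: v) - c| <= e) ->
  `|f (x + a *: v) - f x - a * c| <= e * `|a|.
Proof.
move=> H; have [a0|a0|->] := ltrgtP a 0; last first.
- by rewrite scale0r addr0 subrr mul0r subrr normr0 mulr0.
- have K s : s \in `[0, a] -> derivable f (x + s *: v) v /\
      `|'D_v f (x + s *: v) - c| <= e.
    rewrite in_itv/= => /andP[s0 sa]; have := H (s / a).
    rewrite divfK ?gt_eqF//; apply.
    by rewrite (divr_ge0 s0 (ltW a0))/= ler_pdivrMr// mul1r.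
  have dphi s : s \in `[0, a] ->
      is_derive s 1 (fun s => f (x + s *: v)) ('D_v f (x + s *: v)).
    by move=> sa; apply: is_derive_line; exact: (K s sa).1.
  have dphi' s : s \in `]0, a[ ->
      is_derive s 1 (fun s => f (x + s *: v)) ('D_v f (x + s *: v)).
    by move=> sa; apply: dphi; exact: subset_itv_oo_cc.
  have cphi : {within `[0, a], continuous (fun s => f (x + s *: v))}.
    by apply: derivable_within_continuous => s sa; exact: is_derivable (dphi _ sa).
  have [s sa E] := MVT_segment (ltW a0) dphi' cphi.
  rewrite scale0r addr0 subr0 in E; rewrite E mulrC -mulrBr normrM mulrC.
  by rewrite ler_pM2r ?normr_gt0 ?gt_eqF//; exact: (K s sa).2.
- have K s : s \in `[a, 0] -> derivable f (x + s *: v) v /\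
      `|'D_v f (x + s *: v) - c| <= e.
    rewrite in_itv/= => /andP[sa s0]; have := H (s / a).
    rewrite divfK ?lt_eqF//; apply.
    by rewrite -mulrNN -invrN divr_ge0 ?oppr_ge0 ?(ltW a0)//= ler_pdivrMr ?oppr_gt0// mul1r lerN2.
  have dphi s : s \in `[a, 0] ->
      is_derive s 1 (fun s => f (x + s *: v)) ('D_v f (x + s *: v)).
    by move=> sa; apply: is_derive_line; exact: (K s sa).1.
  have dphi' s : s \in `]a, 0[ ->
      is_derive s 1 (fun s => f (x + s *: v)) ('D_v f (x + s *: v)).
    by move=> sa; apply: dphi; exact: subset_itv_oo_cc.
  have cphi : {within `[a, 0], continuous (fun s => f (x + s *: v))}.
    by apply: derivable_within_continuous => s sa; exact: is_derivable (dphi _ sa).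
  have [s sa E] := MVT_segment (ltW a0) dphi' cphi.
  rewrite scale0r addr0 sub0r mulrN in E.
  rewrite -[f (x + a *: v) - f x]opprB E opprK mulrC -mulrBr normrM mulrC.
  by rewrite ler_pM2r ?normr_gt0 ?lt_eqF//; exact: (K s sa).2.
Qed.

End MeanValue.

Section Box.
Context {R : realType} {N : nat}.
Implicit Types (x y : 'rV[R]_N).

Lemma ball_rVP x r y : 0 < r -> ball x r y <-> forall j, `|x 0 j - y 0 j| < r.
Proof.
move=> r0; split=> [[_ H] j|H]; first exact: H.
by split=> // i j; rewrite ord1; exact: H.
Qed.

Lemma entry_le_norm m n (A : 'M[R]_(m, n)) i j : `|A i j| <= `|A|.
Proof.
by rewrite [leRHS]/Num.Def.normr/= mx_normrE; exact: (le_bigmax _ _ (i, j)).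
Qed.

Lemma norm_le_entries m n (A : 'M[R]_(m, n)) (c : R) :
  0 <= c -> (forall i j, `|A i j| <= c) -> `|A| <= c.
Proof.
by move=> c0 H; rewrite [leLHS]/Num.Def.normr/= mx_normrE (bigmax_le _ c0).
Qed.

Lemma convex_lt (p q a r t : R) : 0 <= t -> t <= 1 ->
  `|p - q| < r -> `|p - a| < r -> `|p - (a + t * (q - a))| < r.
Proof.
move=> t0 t1; rewrite !ltr_norml => /andP[q1 q2] /andP[a1 a2].
have [->|tn0] := eqVneq t 0; first by rewrite mul0r addr0 a1 a2.
have tp : 0 < t by rewrite lt_def tn0.
have H1 : 0 < t * (r + (p - q)) by apply: mulr_gt0 => //; lra.
have H2 : 0 < t * (r - (p - q)) by apply: mulr_gt0 => //; lra.
have H3 : 0 <= (1 - t) * (r + (p - a)) by apply: mulr_ge0; lra.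
have H4 : 0 <= (1 - t) * (r - (p - a)) by apply: mulr_ge0; lra.
by apply/andP; split; lra.
Qed.

Definition stair x y (k : nat) : 'rV[R]_N :=
  \row_j (if (j < k)%N then y 0 j else x 0 j).

Lemma stairS x y (k : 'I_N) :
  stair x y k.+1 = stair x y k + (y 0 k - x 0 k) *: ebase k.
Proof.
apply/rowP => j; rewrite !mxE eqxx /= ltnS leq_eqVlt.
have [->|jk] := eqVneq j k; first by rewrite eqxx ltnn /= mulr1 addrC subrK.
by rewrite val_eqE (negbTE jk) mulr0 addr0.
Qed.

(* The staircase path from x to y stays in the ball of the sup norm. *)
Lemma box_mvt x0 (r e : R) (f : 'rV[R]_N -> R) (c : 'I_N -> R) x y :
  0 <= e ->
  (forall z, ball x0 r z -> forall i,
     derivable f z (ebase i) /\ `|pd i f z - c i| <= e) ->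
  ball x0 r x -> ball x0 r y ->
  `|f y - f x - \sum_i (y - x) 0 i * c i| <= e * N%:R * `|y - x|.
Proof.
move=> e0 H bx yb; have r0 : 0 < r by case: bx.
have -> : f y - f x = \sum_(k < N) (f (stair x y k.+1) - f (stair x y k)).
  rewrite -(big_mkord xpredT (fun k => f (stair x y k.+1) - f (stair x y k))).
  rewrite telescope_sumr//; congr (f _ - f _); apply/rowP => j; rewrite mxE//.
  by rewrite ltn_ord.
rewrite -sumrB (le_trans (ler_norm_sum _ _ _))//.
rewrite -mulrA mulrCA mulr_natl -[X in _ *+ X]card_ord -sumr_const; apply: ler_sum => k _.
rewrite stairS !mxE.
apply: (@le_trans _ _ (e * `|y 0 k - x 0 k|)); last first.
  by rewrite ler_wpM2l// -[X in `|X|](_ : (y - x) 0 k = _) ?entry_le_norm// !mxE.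
apply: dir_mvt => t /andP[t0 t1]; apply: H; apply/ball_rVP => // j.
rewrite !mxE eqxx/=; move/ball_rVP : bx => /(_ r0 j); move/ball_rVP: yb => /(_ r0 j).
have [->|jk] := eqVneq j k; last by rewrite mulr0 addr0; case: ifP.
rewrite ltnn mulr1; exact: convex_lt.
Qed.

Lemma ebase_sum (v : 'rV[R]_N) : v = \sum_i v 0 i *: ebase i.
Proof. exact: row_sum_delta. Qed.

Lemma C1_approx (D : set 'rV[R]_N) (f : 'rV[R]_N -> R) x (e : R) :
  open D -> D x -> Cn 1 D f -> 0 < e ->
  \forall y \near x, `|f y - f x - \sum_i (y - x) 0 i * pd i f x| <= e * `|y - x|.
Proof.
move=> oD Dx Cf e0; pose e' := e / N.+1%:R.
have e'0 : 0 < e' by rewrite divr_gt0.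
have H1 : \forall y \near x, D y by exact: (open_near oD Dx).
have H2 : \forall y \near x, forall i, `|pd i f y - pd i f x| <= e'.
  near=> y => i; move: i; near: y; apply: filter_forall => i.
  have /cvgrPdist_le/(_ _ e'0) := Cn_continuous (Cn_pd i Cf) Dx.
  by apply: filterS => y; rewrite distrC.
have [r /= r0 H] := (nbhs_ballP _ _).1 (filterI H1 H2); near=> y.
have xy : ball x r y by near: y; exact: nbhsx_ballx.
have := @box_mvt x r e' f (fun i => pd i f x) x y (ltW e'0).
move=> /(_ _ (ballxx _ r0) xy) K; apply: le_trans (K _) _.
  by move=> z /H[Dz Hz] i; split; [exact: Cn_derivable Cf Dz|exact: Hz].
by rewrite ler_wpM2r// /e' mulrAC ler_pdivrMr// ler_pM2l// ler_nat.
Unshelve. all: by end_near. Qed.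

Lemma C1_differentiable (D : set 'rV[R]_N) (f : 'rV[R]_N -> R) x :
  open D -> D x -> Cn 1 D f -> differentiable f x.
Proof.
move=> oD Dx Cf.
have lin : linear (fun v : 'rV[R]_N => \sum_i v 0 i * pd i f x : R^o).
  move=> a u v; rewrite scaler_sumr -big_split; apply: eq_bigr => i _ /=.
  by rewrite !mxE mulrDl /GRing.scale/= mulrA.
pose l := GRing.isLinear.Build _ _ _ _ _ lin.
pose L : {linear 'rV[R]_N -> R^o} :=
  HB.pack (fun v : 'rV[R]_N => \sum_i v 0 i * pd i f x : R^o) l.
have [] // := @is_diff_near _ _ _ f L x.
  have CL : Cn 0 setT (fun v : 'rV[R]_N => \sum_i v 0 i * pd i f x).
    apply: Cn_sum => [|i _]; first exact: openT.
    by apply: Cn_mul; [exact: openT|exact: Cn_coord|exact: Cn_cst].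
  by move=> v; exact: Cn_continuous CL _.
by move=> e e0; exact: C1_approx Cf e0.
Qed.

Lemma derive_pd (W : normedModType R) (f : 'rV[R]_N -> W) x v :
  differentiable f x -> 'D_v f x = \sum_i v 0 i *: pd i f x.
Proof.
move=> df; rewrite deriveE// {1}(ebase_sum v) linear_sum; apply: eq_bigr => i _.
by rewrite linearZ/= /pd deriveE.
Qed.

End Box.

Section Chain.
Context {R : realType}.

Lemma is_derive_chain (U V W : normedModType R) (g : U -> V) (f : V -> W) y v :
  derivable g y v -> differentiable f (g y) ->
  is_derive y v (f \o g) ('D_('D_v g y) f (g y)).
Proof.
move=> dg df; pose c h : V := g (h *: v + y).
have c0 : c 0 = g y by rewrite /c scale0r add0r.
have dc : differentiable c 0 by apply: (derivable1_diffP _ _).1; exact: (derivable1P g y v).1.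
have dfc : differentiable (f \o c) 0.
  by apply: differentiable_comp => //; rewrite c0.
have eq1 (X : normedModType R) (h : U -> X) : 'D_v h y = 'D_1 (fun t : R => h (t *: v + y)) 0.
  have E : (fun t : R => t^-1 *: ((h \o shift y) (t *: v) - h y)) =
      (fun t : R => t^-1 *: (((fun s : R => h (s *: v + y)) \o shift 0) (t *: 1)
        - h (0 *: v + y))).
    by apply/funext => t /=; rewrite addr0 scale0r add0r [t *: 1]mulr1.
  by rewrite /derive E.
split; first exact: (derivable1P (f \o g) y v).2 ((derivable1_diffP _ _).2 dfc).
rewrite (eq1 _ (f \o g)) (eq1 _ g) -/c.
rewrite (deriveE _ df) (deriveE _ dc) -[LHS]/('D_1 (f \o c) 0) (deriveE _ dfc).
by rewrite diff_comp ?c0.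
Qed.

Context {N m : nat}.

Lemma pd_comp (f : 'rV[R]_N -> R) (g : 'rV[R]_m -> 'rV[R]_N) y i :
  derivable g y (ebase i) -> differentiable f (g y) ->
  is_derive y (ebase i) (f \o g) (\sum_k pd i g y 0 k * pd k f (g y)).
Proof.
move=> dg df; have := is_derive_chain dg df.
by rewrite (derive_pd _ df).
Qed.

Lemma Cn_comp n (D : set 'rV[R]_m) (E : set 'rV[R]_N) (f : 'rV[R]_N -> R)
    (g : 'rV[R]_m -> 'rV[R]_N) : open D -> open E ->
  (forall y, D y -> E (g y)) ->
  Cn n E f -> Cn n D g -> Cn n D (f \o g).
Proof.
move=> oD oE gDE; elim: n f => [|n IH] f Cf Cg.
  split=> // y Dy; apply: continuous_comp (Cn_continuous Cg Dy) _.
  exact: Cn_continuous Cf (gDE _ Dy).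
have Cf1 : Cn 1 E f by elim: n {IH Cg} Cf => // n IH /Cn_pred.
have H y i : D y -> is_derive y (ebase i) (f \o g) (\sum_k pd i g y 0 k * pd k f (g y)).
  move=> Dy; apply: pd_comp; first exact: Cn_derivable Cg Dy.
  exact: C1_differentiable (gDE _ Dy) Cf1.
split=> [y Dy|i].
  apply: continuous_comp (Cn_continuous Cg Dy) _.
  exact: Cn_continuous Cf (gDE _ Dy).
split=> [y Dy|]; first exact: is_derivable (H y i Dy).
apply: (@Cn_eq _ _ _ _ _ (fun y => \sum_k pd i g y 0 k * (pd k f \o g) y)) => //.
  by move=> y Dy; rewrite -(is_deriveE (H y i Dy)).
apply: Cn_sum => // k _; apply: Cn_mul => //.
  exact: ((Cn_mxP _ _ oD).1 (Cn_pd i Cg)).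
by apply: IH; [exact: Cn_pd|exact: Cn_pred].
Qed.

Lemma smooth_comp (p q : nat) (D : set 'rV[R]_m) (E : set 'rV[R]_N)
    (f : 'rV[R]_N -> 'M[R]_(p, q)) (g : 'rV[R]_m -> 'rV[R]_N) :
  open D -> open E -> (forall y, D y -> E (g y)) ->
  smooth_on E f -> smooth_on D g -> smooth_on D (f \o g).
Proof.
move=> oD oE gDE /smooth_onP sf /smooth_onP sg; apply/smooth_onP => n.
apply/Cn_mxP => // i j; apply: (@Cn_comp _ D E (fun x => f x i j)) => //.
exact: ((Cn_mxP _ _ oE).1 (sf n)).
Qed.

End Chain.

(** * Integration along rays *)

Section RayIntegral.
Context {R : realType} {N : nat} (x0 : 'rV[R]_N).
Implicit Types (x : 'rV[R]_N) (f g : 'rV[R]_N -> R) (k : nat).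
Notation mu := (@lebesgue_measure R).

Definition ray x (t : R) : 'rV[R]_N := x0 + t *: (x - x0).

Definition rayint k f x : R := \int[mu]_(t in `[0, 1]) (t ^+ k * f (ray x t)).

Lemma ray_ball r x t : 0 <= t -> t <= 1 -> ball x0 r x -> ball x0 r (ray x t).
Proof.
move=> t0 t1 bx; have r0 : 0 < r by case: bx.
apply/ball_rVP => // j; move/ball_rVP : bx => /(_ r0 j) H.
by rewrite !mxE; apply: convex_lt => //; rewrite subrr normr0.
Qed.

Lemma ray_continuous x : continuous (ray x).
Proof.
by move=> t; apply: cvgD; [exact: cvg_cst|exact: scalel_continuous].
Qed.

Lemma ballW (rho r : R) : rho <= r -> ball x0 rho `<=` ball x0 r.
Proof. by move=> rr y; exact: le_ball. Qed.

Lemma ball_normP r x : ball x0 r x <-> `|x0 - x| < r.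
Proof. by rewrite mx_norm_ball. Qed.

Lemma smaller_ball r x : ball x0 r x ->
  exists rho, [/\ 0 < rho, rho < r & ball x0 rho x].
Proof.
move=> /ball_normP xr; exists ((`|x0 - x| + r) / 2).
have := normr_ge0 (x0 - x) => n0; split; [lra|lra|].
by apply/ball_normP; lra.
Qed.

Lemma bounded_on_smaller_ball r rho f : 0 < rho -> rho < r ->
  (forall x, ball x0 r x -> {for x, continuous f}) ->
  exists2 M, 0 <= M & forall x, ball x0 rho x -> `|f x| <= M.
Proof.
move=> rho0 rr cf.
pose A := [set v : 'rV[R]_N | forall i, v ord0 i \in `[(x0 0 i - rho), (x0 0 i + rho)]].
have cA : compact A.
  apply: (@rV_compact _ _ (fun i => `[(x0 0 i - rho), (x0 0 i + rho)]%classic)).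
  by move=> i; exact: segment_compact.
have Ar : A `<=` ball x0 r.
  move=> v Av; apply/ball_rVP => [|j]; first exact: lt_trans rr.
  have := Av j; rewrite in_itv/= => /andP[v1 v2].
  by rewrite ltr_norml; apply/andP; split; lra.
have cwf : {within A, continuous f}.
  by apply: continuous_in_subspaceT => v /set_mem Av; exact/cf/Ar.
have [M [_ HM]] := compact_bounded (continuous_compact cwf cA).
exists (`|M| + 1) => [|x bx]; first by rewrite addr_ge0.
apply: (HM (`|M| + 1)); first by rewrite (le_lt_trans (ler_norm M))// ltrDl.
exists x => //; move=> i; move/ball_rVP : bx => /(_ rho0 i).
by rewrite in_itv/= ltr_norml => /andP[v1 v2]; apply/andP; split; lra.
Qed.

Variable r : R.

Lemma ray_within k f x : (forall x, ball x0 r x -> {for x, continuous f}) ->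
  ball x0 r x -> {within `[0, 1], continuous (fun t : R => t ^+ k * f (ray x t))}.
Proof.
move=> cf bx; apply: continuous_in_subspaceT => t /set_mem.
rewrite /= in_itv/= => /andP[t0 t1].
apply: cvgM; first exact: exprn_continuous.
apply: continuous_comp; first exact: ray_continuous.
by apply: cf; exact: ray_ball.
Qed.

Lemma ray_integrable k f x : (forall x, ball x0 r x -> {for x, continuous f}) ->
  ball x0 r x ->
  mu.-integrable `[0, 1] (EFin \o (fun t : R => t ^+ k * f (ray x t))).
Proof.
move=> cf bx; apply: continuous_compact_integrable; first exact: segment_compact.
exact: ray_within.
Qed.

Lemma rayint_dist k f g x (M : R) :
  (forall x, ball x0 r x -> {for x, continuous f}) ->
  (forall x, ball x0 r x -> {for x, continuous g}) ->
  ball x0 r x -> 0 <= M ->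
  (forall z, ball x0 r z -> `|f z - g z| <= M) ->
  `|rayint k f x - rayint k g x| <= M.
Proof.
move=> cf cg bx M0 HM; rewrite -RintegralB//=; [|exact: ray_integrable..].
have ci : mu.-integrable `[0, 1] (EFin \o (fun t : R => t ^+ k * f (ray x t) - t ^+ k * g (ray x t))).
  have H := integrableB _ (ray_integrable k cf bx) (ray_integrable k cg bx).
  by apply: H.
apply: (le_trans (le_normr_Rintegral _ ci)) => //.
have E : \int[mu]_(t in `[0 : R, 1]) M = M.
  by rewrite Rintegral_cst//= lebesgue_measure_itv/= lte_fin ltr01/= subr0 mulr1.
rewrite -[leRHS]E; apply: le_Rintegral => //.
- exact: integrable_norm ci.
- apply: continuous_compact_integrable; first exact: segment_compact.
  by apply: continuous_subspaceT => ?; exact: cst_continuous.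
- move=> t; rewrite /= in_itv/= => /andP[t0 t1].
  rewrite -mulrBr normrM ger0_norm ?exprn_ge0// -[leRHS]mul1r ler_pM ?exprn_ge0//.
    by rewrite exprn_ile1.
  by apply: HM; exact: ray_ball.
Qed.

Lemma rayint0 k x : rayint k (fun=> 0) x = 0.
Proof.
rewrite /rayint (@eq_Rintegral _ _ _ _ _ (fun=> 0)); last by move=> t _; rewrite mulr0.
by rewrite Rintegral_cst// mul0r.
Qed.

Lemma rayint_bound k f x (M : R) :
  (forall x, ball x0 r x -> {for x, continuous f}) ->
  ball x0 r x -> 0 <= M ->
  (forall z, ball x0 r z -> `|f z| <= M) -> `|rayint k f x| <= M.
Proof.
move=> cf bx M0 HM; rewrite -[rayint _ _ _]subr0 -(rayint0 k x).
apply: rayint_dist => // [z _|z /HM]; first exact: cst_continuous.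
by rewrite subr0.
Qed.

Lemma rayint_eq k f g x : (forall z, ball x0 r z -> f z = g z) -> ball x0 r x ->
  rayint k f x = rayint k g x.
Proof.
move=> fg bx; apply: eq_Rintegral => t /set_mem.
rewrite /= in_itv/= => /andP[t0 t1].
by rewrite fg//; exact: ray_ball.
Qed.

Lemma rayint_pd k f x i : Cn 1 (ball x0 r) f -> ball x0 r x ->
  is_derive x (ebase i) (rayint k f) (rayint k.+1 (pd i f) x).
Proof.
move=> Cf bx; have r0 : 0 < r by case: bx.
have cf z : ball x0 r z -> {for z, continuous f} by exact: Cn_continuous Cf.
have [rho [rho0 rr bxr]] := smaller_ball bx.
have [M M0 HM] := bounded_on_smaller_ball rho0 rr
  (fun z bz => Cn_continuous (Cn_pd i Cf) bz).
have [d d0 Hd] : exists2 d : R, 0 < d & forall h : R, `|h| < d -> ball x0 rho (h *: ebase i + x).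
  exists (rho - `|x0 - x|) => [|h hd].
    by move/ball_normP: bxr; lra.
  apply/ball_normP.
  rewrite (_ : _ - _ = (x0 - x) - h *: ebase i); last by rewrite opprD addrCA addrC.
  have h1 : `|h *: ebase i : 'rV[R]_N| <= `|h|.
    apply: norm_le_entries => // a b; rewrite !mxE normrM.
    by case: andP => _; rewrite ?normr1 ?normr0 ?mulr1 ?mulr0.
  have := ler_normB (x0 - x) (h *: ebase i : 'rV[R]_N); lra.
pose F (h : R) (t : R) := t ^+ k * f (ray (h *: ebase i + x) t).
have rayE h t : ray (h *: ebase i + x) t = ray x t + h *: (t *: ebase i).
  rewrite /ray -addrA [in LHS]scalerDr addrA -addrA [_ + t *: (x - x0)]addrC addrA.
  by rewrite !scalerA [h * t]mulrC.
have dF (h t : R) : `|h| < d -> 0 <= t <= 1 ->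
    is_derive h 1 (F ^~ t) (t ^+ k.+1 * pd i f (ray (h *: ebase i + x) t)).
  move=> hd /andP[t0 t1].
  have bz : ball x0 r (ray (h *: ebase i + x) t).
    by apply: ray_ball => //; apply: ballW (ltW rr) _ _; exact: Hd.
  have df : differentiable f (ray (h *: ebase i + x) t).
    by apply: C1_differentiable bz Cf; exact: ball_open.
  have H : is_derive h 1 (fun h => f (ray x t + h *: (t *: ebase i)))
      ('D_(t *: ebase i) f (ray x t + h *: (t *: ebase i))).
    by apply: is_derive_line; rewrite -rayE; exact: diff_derivable.
  have -> : F ^~ t = (t ^+ k) *: (fun h => f (ray x t + h *: (t *: ebase i))).
    by apply/funext => h'; rewrite /F rayE.
  rewrite exprSr -mulrA.
  have -> : t * pd i f (ray (h *: ebase i + x) t) = 'D_(t *: ebase i) f (ray x t + h *: (t *: ebase i)).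
    by rewrite -rayE (deriveE _ df) linearZ/= -(deriveE _ df).
  exact: is_deriveZ.
have I0 : `]- d, d[%classic 0 by rewrite /= in_itv/= oppr_lt0 d0.
have IP h : `]- d, d[%classic h -> `|h| < d by rewrite /= in_itv/= ltr_norml.
have key : h^-1 *: ((\int[mu]_(t in `[0, 1]) F (h + 0) t) - (\int[mu]_(t in `[0, 1]) F 0 t)) @[h --> 0^'] -->
    \int[mu]_(t in `[0, 1]) (partial1of2 F) 0 t.
  apply: (@cvg_differentiation_under_integral _ _ _ mu F `[0, 1]%classic _ 0 (- d) d I0 _ _ (fun=> M)) => //.
  - move=> h /IP hd; apply: ray_integrable => //.
    by apply: ballW (ltW rr) _ _; exact: Hd.
  - by move=> h t /IP hd; rewrite /= in_itv/= => tt; exact: is_derivable (dF _ _ hd tt).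
  - apply: continuous_compact_integrable; first exact: segment_compact.
    by apply: continuous_subspaceT => ?; exact: cst_continuous.
  - move=> h t /IP hd; rewrite /= in_itv/= => tt.
    rewrite partial1of2E (is_deriveE (dF _ _ hd tt)); case/andP : tt => t0 t1.
    rewrite normrM ger0_norm ?exprn_ge0// -[leRHS]mul1r ler_pM ?exprn_ge0//.
      by rewrite exprn_ile1.
    by apply: HM; apply: ray_ball => //; exact: Hd.
have E : \int[mu]_(t in `[0, 1]) (partial1of2 F) 0 t = rayint k.+1 (pd i f) x.
  apply: eq_Rintegral => t /set_mem; rewrite /= in_itv/= => tt.
  rewrite partial1of2E (is_deriveE (dF _ _ _ tt)) ?normr0//.
  by rewrite scale0r add0r.
have G : (fun h : R => h^-1 *: ((\int[mu]_(t in `[0, 1]) F (h + 0) t) - (\int[mu]_(t in `[0, 1]) F 0 t))) =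
    (fun h : R => h^-1 *: ((rayint k f \o shift x) (h *: ebase i) - rayint k f x)).
  have E0 h : \int[mu]_(t in `[0, 1]) F h t = rayint k f (h *: ebase i + x) by [].
  by apply/funext => h; rewrite !E0 addr0 scale0r add0r.
rewrite G E in key.
split; first by apply/cvg_ex; exists (rayint k.+1 (pd i f) x).
exact/cvg_lim.
Qed.

Lemma lipschitz_continuous f x (K : R) :
  (\forall y \near x, `|f y - f x| <= K * `|y - x|) -> {for x, continuous f}.
Proof.
move=> H; apply: (@cvgrPdist_le _ _ _ (nbhs x) _ _ _).2 => e e0.
have K0 : 0 < `|K| + 1 by rewrite ltr_wpDl.
have H2 : \forall y \near x, `|x - y| < e / (`|K| + 1).
  by apply: (@cvgr_dist_lt _ _ _ (nbhs x) _ id) => //; rewrite divr_gt0.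
apply: filterS2 H H2 => y H1 H2; rewrite distrC.
apply: (le_trans H1); apply: (@le_trans _ _ ((`|K| + 1) * `|y - x|)).
  by rewrite ler_wpM2r// (le_trans (ler_norm K))// lerDl.
by rewrite mulrC -ler_pdivlMr// ltW// distrC.
Qed.

End RayIntegral.

Section RaySmooth.
Context {R : realType} {N : nat} (x0 : 'rV[R]_N).
Implicit Types (x : 'rV[R]_N) (f g : 'rV[R]_N -> R) (k : nat).

Lemma rayint_continuous r k f x : Cn 1 (ball x0 r) f -> ball x0 r x ->
  {for x, continuous (rayint x0 k f)}.
Proof.
move=> Cf bx.
have [rho [rho0 rr bxr]] := smaller_ball bx.
have cdf i z : ball x0 r z -> {for z, continuous (pd i f)}.
  exact: Cn_continuous (Cn_pd i Cf).
have /choice[M HM] : forall i, exists M, 0 <= M /\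
    forall z, ball x0 rho z -> `|pd i f z| <= M.
  by move=> i; have [M] := bounded_on_smaller_ball rho0 rr (cdf i); exists M.
pose K := \sum_i M i.
have K0 : 0 <= K by apply: sumr_ge0 => i _; case: (HM i).
have MK i : M i <= K.
  by rewrite /K (bigD1 i)//= lerDl sumr_ge0// => j _; case: (HM j).
apply: (@lipschitz_continuous _ _ _ _ (K * N%:R)).
have nx : \forall y \near x, ball x0 rho y.
  by apply: open_nbhs_nbhs; split => //; exact: ball_open.
apply: filterS nx => y bxy.
have H : forall z, ball x0 rho z -> forall i,
    derivable (rayint x0 k f) z (ebase i) /\ `|pd i (rayint x0 k f) z - 0| <= K.
  move=> z bz i; have bz' := ballW (ltW rr) bz.
  have D := rayint_pd k i Cf bz'; split; first exact: is_derivable D.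
  rewrite subr0 /pd (is_deriveE D); apply: (@rayint_bound _ _ _ rho) => // u bu.
    by apply: (cdf i); exact: ballW (ltW rr) _ bu.
  by apply: le_trans (MK i); exact: (HM i).2.
have := box_mvt K0 H bxr bxy.
by rewrite big1 ?subr0// => i _; rewrite mulr0.
Qed.

Lemma rayint_Cn n r k f : (forall m, Cn m (ball x0 r) f) ->
  Cn n (ball x0 r) (rayint x0 k f).
Proof.
elim: n k f => [|n IH] k f Cf;
  (split; first by move=> x bx; exact: rayint_continuous (Cf 1%N) bx) => // i.
split=> [x bx|]; first exact: is_derivable (rayint_pd k i (Cf 1%N) bx).
apply: (@Cn_eq _ _ _ _ _ (rayint x0 k.+1 (pd i f))).
- exact: ball_open.
- by move=> x bx; rewrite -(is_deriveE (rayint_pd k i (Cf 1%N) bx)).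
- by apply: IH => m; exact: Cn_pd (Cf m.+1).
Qed.

Lemma rayint_sum k r (I : Type) (s : seq I) (F : I -> 'rV[R]_N -> R) x :
  (forall i x, ball x0 r x -> {for x, continuous (F i)}) -> ball x0 r x ->
  rayint x0 k (fun y => \sum_(i <- s) F i y) x = \sum_(i <- s) rayint x0 k (F i) x.
Proof.
move=> cF bx; elim: s => [|i s IH].
  by under [X in rayint _ _ X]eq_fun do rewrite big_nil; rewrite big_nil rayint0.
under [X in rayint _ _ X]eq_fun do rewrite big_cons.
have cS z : ball x0 r z -> {for z, continuous (fun y => \sum_(i <- s) F i y)}.
  have : Cn 0 (ball x0 r) (fun y => \sum_(i <- s) F i y).
    by apply: Cn_sum; [exact: ball_open|move=> j _; split=> // u bu; exact: cF].
  exact: Cn_continuous.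
rewrite big_cons -IH /rayint -RintegralD//=.
- by apply: eq_Rintegral => t _; rewrite mulrDr.
- exact: ray_integrable (cF i) bx.
- exact: ray_integrable cS bx.
Qed.

Lemma rayintZ k r (c : R) f x :
  (forall x, ball x0 r x -> {for x, continuous f}) -> ball x0 r x ->
  rayint x0 k (fun y => c * f y) x = c * rayint x0 k f x.
Proof.
move=> cf bx; rewrite /rayint -RintegralZl//=; last exact: ray_integrable cf bx.
by apply: eq_Rintegral => t _; rewrite mulrCA.
Qed.

(* The fundamental theorem of calculus for [t |-> t * f (x0 + t *: (x - x0))]. *)
Lemma rayint_ftc r f x : Cn 1 (ball x0 r) f -> ball x0 r x ->
  f x = rayint x0 0 f x + \sum_j (x - x0) 0 j * rayint x0 1 (pd j f) x.
Proof.
move=> Cf bx; have cf z : ball x0 r z -> {for z, continuous f} by exact: Cn_continuous Cf.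
have cdf i z : ball x0 r z -> {for z, continuous (pd i f)}.
  exact: Cn_continuous (Cn_pd i Cf).
pose G y := \sum_j (x - x0) 0 j * pd j f y.
have CG : Cn 0 (ball x0 r) G.
  apply: Cn_sum => [|j _]; first exact: ball_open.
  apply: Cn_mul; [exact: ball_open|exact: Cn_cst|exact: Cn_pd].
have cG z : ball x0 r z -> {for z, continuous G} by exact: Cn_continuous CG.
pose dF (t : R) := t ^+ 0 * f (ray x0 x t) + t ^+ 1 * G (ray x0 x t).
pose F (t : R) := t * f (ray x0 x t).
have HF (t : R) : 0 <= t <= 1 -> is_derive t 1 F (dF t).
  move=> /andP[t0 t1].
  have bz : ball x0 r (ray x0 x t) by exact: ray_ball.
  have df : differentiable f (ray x0 x t).
    by apply: C1_differentiable bz Cf; exact: ball_open.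
  have H : is_derive t 1 (fun h => f (ray x0 x h)) ('D_(x - x0) f (ray x0 x t)).
    by apply: is_derive_line; exact: diff_derivable.
  have : is_derive t 1 (id * (fun h => f (ray x0 x h)))
     (t *: 'D_(x - x0) f (ray x0 x t) + f (ray x0 x t) *: 1).
    exact: is_deriveM.
  congr is_derive; rewrite /dF expr0 mul1r addrC [_ *: 1]mulr1; congr (_ + _).
  by rewrite (derive_pd _ df) expr1.
have I1 := ray_integrable 0 cf bx.
have I2 := ray_integrable 1 cG bx.
have -> : f x = \int[lebesgue_measure]_(t in `[0, 1]) dF t.
  rewrite /Rintegral (@continuous_FTC2 _ _ F)//=.
  - by rewrite /F mul1r mul0r /ray scale1r addrCA subrr addr0 subr0.
  - apply: continuous_in_subspaceT => t /set_mem; rewrite /= in_itv/= => /andP[t0 t1].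
    have bz : ball x0 r (ray x0 x t) by exact: ray_ball.
    apply: cvgD; apply: cvgM; try exact: exprn_continuous.
      by apply: continuous_comp; [exact: ray_continuous|exact: cf].
    by apply: continuous_comp; [exact: ray_continuous|exact: cG].
  - have CF (t : R) : 0 <= t <= 1 -> {for t, continuous F}.
      by move=> /HF /is_derivable /derivable1_diffP /differentiable_continuous.
    split.
    + move=> t; rewrite in_itv/= => /andP[t0 t1].
      by apply: is_derivable; apply: HF; rewrite !ltW.
    + by apply: cvg_at_right_filter; apply: CF; rewrite lexx ler01.
    + by apply: cvg_at_left_filter; apply: CF; rewrite lexx ler01.
  - move=> t; rewrite in_itv/= => /andP[t0 t1].
    by rewrite derive1E; apply: is_deriveE; apply: HF; rewrite !ltW.
rewrite /dF RintegralD//=; congr (_ + _).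
rewrite -[LHS]/(rayint x0 1 G x) (@rayint_sum 1 r) => [|i z bz|//].
  by apply: eq_bigr => j _; rewrite (@rayintZ 1 r)// => z bz; exact: cdf.
have : Cn 0 (ball x0 r) (fun y => (x - x0) 0 i * pd i f y).
  apply: Cn_mul; [exact: ball_open|exact: Cn_cst|exact: Cn_pd].
by move=> /Cn_continuous; exact.
Qed.

Lemma poincare r (a : 'I_N -> 'rV[R]_N -> R) : 0 < r ->
  (forall i, smooth_on (ball x0 r) (a i)) ->
  (forall x, ball x0 r x -> forall i j, pd i (a j) x = pd j (a i) x) ->
  exists f, [/\ smooth_on (ball x0 r) f, f x0 = 0 &
    forall x, ball x0 r x -> forall i, pd i f x = a i x].
Proof.
move=> r0 sa sym; have oB : open (ball x0 r) by exact: ball_open.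
have Ca i n : Cn n (ball x0 r) (a i) by exact: (smooth_onP _ _).1.
pose f x := \sum_j (x 0 j - x0 0 j) * rayint x0 0 (a j) x.
have Cf n : Cn n (ball x0 r) f.
  apply: Cn_sum => // j _; apply: Cn_mul => //.
    by apply: Cn_add => //; [exact: Cn_coord|exact: Cn_cst].
  exact: rayint_Cn.
exists f; split; first exact/smooth_onP.
  by rewrite /f big1// => j _; rewrite subrr mul0r.
move=> x bx i.
have dc j : is_derive x (ebase i) (fun y : 'rV[R]_N => y 0 j - x0 0 j) (i == j)%:R.
  have -> : (i == j)%:R = ebase i 0 j - 0 :> R.
    by rewrite subr0 /ebase mxE eqxx/= eq_sym.
  have H := is_derive_coord x (ebase i) 0 j; exact: is_deriveB.
have dr j := rayint_pd 0 i (Ca j 1%N) bx.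
rewrite pd_sum => [|j _]; last first.
  by apply: derivableM; [exact: is_derivable (dc j)|exact: is_derivable (dr j)].
under eq_bigr => j _.
  rewrite pdM; [|exact: is_derivable (dc j)|exact: is_derivable (dr j)].
  rewrite /pd (is_deriveE (dc j)) (is_deriveE (dr j)) -/(pd i (a j)).
  rewrite (@rayint_eq _ _ _ r 1 _ (pd j (a i)))//; last by move=> z bz; exact: sym.
  over.
rewrite big_split/= [in RHS](rayint_ftc (Ca i 1%N) bx) addrC; congr (_ + _).
  rewrite (bigD1 i)//= eqxx mul1r big1 ?addr0// => j /negbTE ji.
  by rewrite eq_sym ji mul0r.
by apply: eq_bigr => j _; rewrite !mxE.
Qed.

End RaySmooth.

(** * Integrable linear systems *)

Section GeometricLimits.
Context {R : realType}.

Lemma le_geometric (a b c : R) : (forall n, a <= b + c / 2 ^+ n) -> a <= b.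
Proof.
move=> H; rewrite leNgt; apply/negP => ba.
have ab0 : 0 < a - b by lra.
have [n Hn] : exists n : nat, c / (a - b) < n%:R.
  exists (Num.truncn (c / (a - b))).+1; exact: truncnS_gt.
have n2 : n%:R <= 2 ^+ n :> R by rewrite -natrX ler_nat ltnW// ltn_expl.
have : c / 2 ^+ n < a - b.
  rewrite ltr_pdivrMr ?exprn_gt0// mulrC.
  by rewrite -ltr_pdivrMr//; exact: lt_le_trans n2.
have := H n; lra.
Qed.

Lemma geometric_limit (u : nat -> R) (c : R) :
  (forall n, `|u n.+1 - u n| <= c / 2 ^+ n) ->
  exists l, forall n, `|u n - l| <= 2 * c / 2 ^+ n.
Proof.
move=> H; pose d n : R := 2 * c / 2 ^+ n.
have dS n : d n = d n.+1 + c / 2 ^+ n.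
  by rewrite /d exprS invfM; field; rewrite expf_neq0.
have lo n : u n - d n <= u n.+1 - d n.+1.
  by have := H n; rewrite ler_norml => /andP[h1 h2]; rewrite (dS n); lra.
have up n : u n.+1 + d n.+1 <= u n + d n.
  by have := H n; rewrite ler_norml => /andP[h1 h2]; rewrite (dS n); lra.
have lom : {homo (fun n => u n - d n) : n m / (n <= m)%N >-> n <= m}.
  exact: homo_leq (@lexx _ R) (@le_trans _ R) lo.
have upm : {homo (fun n => u n + d n) : n m / (n <= m)%N >-> m <= n}.
  apply: homo_leq => [//|y x z xy yz|//]; exact: le_trans yz xy.
have d0 n : 0 <= d n.
  have c0 : 0 <= c by have := H 0%N; rewrite expr0 divr1; exact: le_trans.
  by rewrite /d divr_ge0// ?mulr_ge0// exprn_ge0.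
have cross n m : u n - d n <= u m + d m.
  apply: le_trans (lom _ _ (leq_maxl n m)) _.
  apply: le_trans (upm _ _ (leq_maxr n m)); have := d0 (maxn n m); lra.
pose S := [set u n - d n | n in [set: nat]].
have hS : has_sup S.
  split; first by exists (u 0%N - d 0%N); exists 0%N.
  by exists (u 0%N + d 0%N) => _ [n _ <-].
exists (sup S) => n; rewrite -/(d n) ler_norml; apply/andP; split.
  have : sup S <= u n + d n.
    by apply: ge_sup => [|_ [m _ <-]]; [case: hS|exact: cross].
  lra.
have : u n - d n <= sup S by apply: ub_le_sup => //; [case: hS|exists n].
lra.
Qed.

Lemma geometric_limit_continuous (T : topologicalType) (D : set T)
    (f : nat -> T -> R) (g : T -> R) (c : R) x : open D -> D x ->
  (forall n y, D y -> `|f n y - g y| <= c / 2 ^+ n) ->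
  (forall n, {for x, continuous (f n)}) -> {for x, continuous g}.
Proof.
move=> oD Dx H cf; apply/cvgrPdist_le => e e0.
have [n Hn] : exists n, c / 2 ^+ n <= e / 3.
  apply: contrapT => K; have : e / 3 <= 0; last lra.
  apply: (@le_geometric _ _ c) => n; rewrite add0r leNgt; apply/negP => L.
  by apply: K; exists n; exact: ltW.
have e3 : 0 < e / 3 by lra.
have nD : \forall y \near x, D y.
  by apply: open_nbhs_nbhs.
near=> y.
have Dy : D y by near: y.
have K1 := le_trans (H n y Dy) Hn.
have K2 := le_trans (H n x Dx) Hn.
have K3 : `|f n x - f n y| <= e / 3.
  by near: y; have /cvgrPdist_le := cf n; apply.
move: K1 K2 K3; rewrite !ler_norml => /andP[? ?] /andP[? ?] /andP[? ?].
by apply/andP; split; lra.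
Unshelve. all: by end_near. Qed.

Lemma geometric_limit_derive (V : normedModType R) (D : set V) (v : V)
    (f : nat -> V -> R) (g dg : V -> R) (c : R) x : open D -> D x ->
  (forall n y, D y -> `|f n y - g y| <= c / 2 ^+ n) ->
  (forall n y, D y -> derivable (f n) y v) ->
  (forall n y, D y -> `|'D_v (f n) y - dg y| <= c / 2 ^+ n) ->
  {for x, continuous dg} -> is_derive x v g (dg x).
Proof.
move=> oD Dx Hf df Hdf cdg.
have key : forall e, 0 < e -> \forall h \near (0 : R)^',
    `|dg x - h^-1 *: (g (h *: v + x) - g x)| <= e.
  move=> e e0.
  have H1 : \forall y \near x, D y by exact: open_nbhs_nbhs.
  have H2 : \forall y \near x, `|dg y - dg x| <= e.
    have /cvgrPdist_le/(_ _ e0) := cdg.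
    by apply: filterS => y; rewrite distrC.
  have [d /= d0 Hd] := (nbhs_ballP _ _).1 (filterI H1 H2).
  have vd : 0 < d / (`|v| + 1) by rewrite divr_gt0// ltr_wpDl.
  have H3 : \forall h \near (0 : R)^', `|h| < d / (`|v| + 1).
    exact: dnbhs0_lt.
  have H4 : \forall h \near (0 : R)^', h != 0 by exact: nbhs_dnbhs_neq.
  apply: filterS2 H3 H4 => h hd h0.
  have seg t : 0 <= t <= 1 -> D (x + (t * h) *: v) /\ `|dg (x + (t * h) *: v) - dg x| <= e.
    move=> /andP[t0 t1]; apply: Hd; rewrite -ball_normE /ball_/= opprD addNKr normrN.
    rewrite normrZ normrM ger0_norm//.
    apply: (@le_lt_trans _ _ (`|h| * (`|v| + 1))).
      apply: (@le_trans _ _ (1 * `|h| * `|v|)).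
        by rewrite ler_wpM2r// ler_wpM2r.
      by rewrite mul1r ler_wpM2l// lerDl.
    by rewrite -ltr_pdivlMr// ltr_wpDl.
  have Dh : D (x + h *: v) by have := (seg 1 _).1; rewrite mul1r; apply; rewrite ler01 lexx.
  have main : `|g (x + h *: v) - g x - h * dg x| <= e * `|h|.
    apply: (@le_geometric _ _ (c * (`|h| + 2))) => n.
    have K1 := Hf n _ Dh; have K2 := Hf n _ Dx.
    have K3 : `|f n (x + h *: v) - f n x - h * dg x| <= (e + c / 2 ^+ n) * `|h|.
      apply: dir_mvt => t tt; have [Dt gt] := seg t tt; split; first exact: df.
      have K4 := Hdf n _ Dt.
      rewrite -(subrKA (dg (x + (t * h) *: v))) addrC.
      exact: le_trans (ler_normD _ _) (lerD gt K4).
    move: K1 K2 K3; set a := c / 2 ^+ n.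
    have -> : c * (`|h| + 2) / 2 ^+ n = a * `|h| + a + a by rewrite /a; ring.
    rewrite mulrDl !ler_norml => /andP[? ?] /andP[? ?] /andP[? ?].
    by apply/andP; split; lra.
  have -> : dg x - h^-1 *: (g (h *: v + x) - g x) =
      - (h^-1 * (g (x + h *: v) - g x - h * dg x)).
    by rewrite [h *: v + x]addrC; set G := g (x + _); rewrite /GRing.scale/=; field.
  by rewrite normrN normrM normfV mulrC ler_pdivrMr ?normr_gt0.
have cv : h^-1 *: (g (h *: v + x) - g x) @[h --> (0 : R)^'] --> dg x.
  exact/cvgrPdist_le.
split; first by apply/cvg_ex; exists (dg x).
exact/cvg_lim.
Qed.

End GeometricLimits.

Section Picard.
Context {R : realType} {N m : nat} (x0 : 'rV[R]_N) (r C : R).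
Variable A : 'I_N -> 'rV[R]_N -> 'M[R]_m.
Let B := ball x0 r.
Hypotheses (r0 : 0 < r) (C0 : 0 <= C).
Hypothesis sA : forall i, smooth_on B (A i).
Hypothesis boundA : forall i x, B x -> forall P : 'M[R]_m, `|A i x *m P| <= C * `|P|.
Hypothesis small : N%:R * r * C <= 8^-1.
Hypothesis integrable : forall x, B x -> forall i j,
  pd i (A j) x - pd j (A i) x = A i x *m A j x - A j x *m A i x.

Definition picard_step (P : 'rV[R]_N -> 'M[R]_m) (x : 'rV[R]_N) : 'M[R]_m :=
  \matrix_(a, b) ((a == b)%:R +
    \sum_j (x - x0) 0 j * rayint x0 0 (fun y => (A j y *m P y) a b) x).

Definition picard (n : nat) : 'rV[R]_N -> 'M[R]_m :=
  iter n picard_step (fun=> 1%:M).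

Let oB : open B. Proof. exact: ball_open. Qed.

Let CA i n : Cn n B (A i). Proof. exact: (smooth_onP _ _).1. Qed.

Lemma picard_Cn n k : Cn k B (picard n).
Proof.
elim: n k => [|n IH] k; first exact: Cn_cst.
apply/Cn_mxP => // a b.
under eq_fun do rewrite mxE.
apply: Cn_add => //; first exact: Cn_cst.
apply: Cn_sum => // j _; apply: Cn_mul => //.
  under eq_fun do rewrite !mxE.
  by apply: Cn_add => //; [exact: Cn_coord|exact: Cn_cst].
apply: rayint_Cn => l; apply: ((Cn_mxP _ _ oB).1).
exact: Cn_mulmx.
Qed.

Let CAP i n k a b : Cn k B (fun y => (A i y *m picard n y) a b).
Proof. by apply: ((Cn_mxP _ _ oB).1); apply: Cn_mulmx => //; exact: picard_Cn. Qed.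

Let sum_bound (w : 'I_N -> R) (M : R) x : B x -> (forall j, `|w j| <= M) ->
  `|\sum_j (x - x0) 0 j * w j| <= N%:R * r * M.
Proof.
move=> Bx wM; rewrite (le_trans (ler_norm_sum _ _ _))//.
rewrite -mulrA mulr_natl -[X in _ *+ X]card_ord -sumr_const.
apply: ler_sum => j _; rewrite normrM ler_pM//.
apply: (le_trans (entry_le_norm _ _ _)); move/ball_normP: Bx.
by rewrite distrC; exact: ltW.
Qed.

Let dim_bound (P : 'M[R]_m) (M : R) : 0 <= M ->
  (forall a b, `|P a b| <= M) -> `|P| <= M.
Proof. exact: norm_le_entries. Qed.

Lemma picard_cauchy n x : B x -> `|picard n.+1 x - picard n x| <= 1 / 2 ^+ n.
Proof.
elim: n x => [|n IH] x Bx.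
  rewrite expr0 divr1; apply: dim_bound => // a b.
  rewrite !mxE addrAC addrN add0r.
  have H : `|\sum_j (x - x0) 0 j * rayint x0 0 (fun y => (A j y *m picard 0 y) a b) x|
      <= N%:R * r * C.
    apply: sum_bound => // j; apply: (rayint_bound (r := r)) => //.
      by move=> z Bz; exact: Cn_continuous (CAP j 0 0 a b) Bz.
    move=> z Bz; apply: (le_trans (entry_le_norm _ _ _)).
    apply: (le_trans (boundA _ Bz _)); rewrite -[leRHS]mulr1 ler_wpM2l//.
    by apply: dim_bound => // i j'; rewrite !mxE; case: eqP; rewrite ?normr1 ?normr0.
  by apply: (le_trans H); apply: (le_trans small); lra.
have p0 : 0 <= 1 / 2 ^+ n.+1 :> R by rewrite divr_ge0// exprn_ge0.
apply: dim_bound => // a b; rewrite !mxE opprD addrACA subrr add0r -sumrB.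
under eq_bigr do rewrite -mulrBr.
apply: (@le_trans _ _ (N%:R * r * (C * (1 / 2 ^+ n)))).
  have p0' : 0 <= C * (1 / 2 ^+ n) by rewrite !mulr_ge0// invr_ge0 exprn_ge0.
  apply: sum_bound => // j; apply: (rayint_dist (r := r)) => //.
  - by move=> z Bz; exact: Cn_continuous (CAP j n.+1 0 a b) Bz.
  - by move=> z Bz; exact: Cn_continuous (CAP j n 0 a b) Bz.
  move=> z Bz; have -> : (A j z *m picard n.+1 z) a b - (A j z *m picard n z) a b =
      (A j z *m (picard n.+1 z - picard n z)) a b by rewrite mulmxBr !mxE.
  apply: (le_trans (entry_le_norm _ _ _)); apply: (le_trans (boundA _ Bz _)).
  by rewrite ler_wpM2l// IH.
have pn : 0 <= (2 ^+ n)^-1 :> R by rewrite invr_ge0 exprn_ge0.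
have := ler_wpM2r pn small.
by rewrite exprS invfM !div1r [N%:R * r * (C * _)]mulrA; move: pn; set p := (2 ^+ n)^-1; lra.
Qed.

(* By the integrability condition the error of the next iterate is an integral
   of size at most 2 N r C times the error of the current one, up to a term
   bounded by [picard n.+1 - picard n]. *)
Definition picard_error n i x := pd i (picard n) x - A i x *m picard n x.

Lemma picard_errorS n i x : B x -> picard_error n.+1 i x =
  \matrix_(a, b) \sum_j (x - x0) 0 j *
    (rayint x0 1 (pd i (fun y => (A j y *m picard n y) a b)) x
     - rayint x0 1 (pd j (fun y => (A i y *m picard n y) a b)) x)
  + A i x *m (picard n x - picard n.+1 x).
Proof.
move=> Bx; apply/matrixP => a b.
have dc j : is_derive x (ebase i) (fun y : 'rV[R]_N => (y - x0) 0 j) (i == j)%:R.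
  have -> : (fun y : 'rV[R]_N => (y - x0) 0 j) = (fun y : 'rV[R]_N => y 0 j - x0 0 j).
    by apply/funext => y; rewrite !mxE.
  have -> : (i == j)%:R = ebase i 0 j - 0 :> R.
    by rewrite subr0 /ebase mxE eqxx/= eq_sym.
  by have H := is_derive_coord x (ebase i) 0 j; exact: is_deriveB.
have dr j := rayint_pd 0 i (CAP j n 1 a b) Bx.
have dP : derivable (picard n.+1) x (ebase i).
  exact: Cn_derivable (picard_Cn n.+1 1) Bx.
have -> : picard_error n.+1 i x a b = pd i (fun y => picard n.+1 y a b) x
    - (A i x *m picard n.+1 x) a b.
  by rewrite /picard_error -pd_mxE// !mxE.
have -> : pd i (fun y => picard n.+1 y a b) x =
    rayint x0 0 (fun y => (A i y *m picard n y) a b) x +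
    \sum_j (x - x0) 0 j * rayint x0 1 (pd i (fun y => (A j y *m picard n y) a b)) x.
  have dt j : is_derive x (ebase i) (fun y => (y - x0) 0 j *
      rayint x0 0 (fun y => (A j y *m picard n y) a b) y)
      ((i == j)%:R * rayint x0 0 (fun y => (A j y *m picard n y) a b) x +
       (x - x0) 0 j * rayint x0 1 (pd i (fun y => (A j y *m picard n y) a b)) x).
    have := is_deriveM (dc j) (dr j); congr is_derive.
    by rewrite addrC [in LHS]/GRing.scale/= [X in X + _]mulrC.
  have -> : (fun y => picard n.+1 y a b) = (fun y => (a == b)%:R +
     \sum_j (y - x0) 0 j * rayint x0 0 (fun y => (A j y *m picard n y) a b) y).
    by apply/funext => y; rewrite /picard iterS mxE.
  have := is_deriveD (is_derive_cst ((a == b)%:R : R) x (ebase i))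
    (is_derive_sumr (index_enum _) (P := xpredT) (fun j _ => dt j)).
  move=> /is_deriveE; rewrite add0r /pd => ->.
  rewrite big_split/=; congr (_ + _).
  rewrite (bigD1 i)//= eqxx mul1r big1 ?addr0// => j /negbTE ji.
  by rewrite eq_sym ji mul0r.
have F := rayint_ftc (CAP i n 1 a b) Bx.
have mxD (P Q : 'M[R]_m) : (P + Q) a b = P a b + Q a b by rewrite mxE.
have mxN (P : 'M[R]_m) : (- P) a b = - P a b by rewrite mxE.
rewrite mxD mulmxBr mxD mxN F [X in _ = X + _]mxE.
under [in RHS]eq_bigr do rewrite mulrBr.
have alg (u s t q : R) : u + s - q = (s - t) + (u + t - q) by ring.
by rewrite sumrB; exact: alg.
Qed.

Lemma picard_error_bound n i x : B x -> `|picard_error n i x| <= 4 * C / 2 ^+ n.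
Proof.
elim: n i x => [|n IH] i x Bx.
  rewrite /picard_error /picard/= pd_cst sub0r normrN expr0 divr1.
  apply: (le_trans (boundA _ Bx _)).
  have H : `|1%:M : 'M[R]_m| <= 1.
    by apply: dim_bound => // a b; rewrite !mxE; case: eqP; rewrite ?normr1 ?normr0.
  by have := ler_wpM2l C0 H; have := C0; lra.
rewrite picard_errorS//.
pose e := 4 * C / 2 ^+ n.
have e0 : 0 <= e by rewrite /e divr_ge0 ?mulr_ge0// exprn_ge0.
apply: (le_trans (ler_normD _ _)).
have H1 : `|A i x *m (picard n x - picard n.+1 x)| <= e / 4.
  apply: (le_trans (boundA _ Bx _)); rewrite distrC.
  have := ler_wpM2l C0 (picard_cauchy n Bx); rewrite /e; move=> H.
  apply: (le_trans H); rewrite div1r.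
  by have -> : 4 * C / 2 ^+ n / 4 = C / 2 ^+ n by field; rewrite expf_neq0.
have H2 : `|\matrix_(a, b) \sum_j (x - x0) 0 j *
    (rayint x0 1 (pd i (fun y => (A j y *m picard n y) a b)) x
     - rayint x0 1 (pd j (fun y => (A i y *m picard n y) a b)) x) : 'M[R]_m| <= e / 4.
  apply: dim_bound => [|a b]; first by rewrite divr_ge0.
  rewrite mxE; apply: (@le_trans _ _ (N%:R * r * (C * e + C * e))); last first.
    have H := ler_wpM2r e0 small.
    have -> : N%:R * r * (C * e + C * e) = N%:R * r * C * e + N%:R * r * C * e by ring.
    lra.
  have p0' : 0 <= C * e + C * e by rewrite addr_ge0// mulr_ge0.
  apply: sum_bound => // j; apply: (rayint_dist (r := r)) => //.
  - by move=> z Bz; exact: Cn_continuous (Cn_pd i (CAP j n 1 a b)) Bz.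
  - by move=> z Bz; exact: Cn_continuous (Cn_pd j (CAP i n 1 a b)) Bz.
  move=> z Bz.
  have dA k l : derivable (A k) z (ebase l) by exact: Cn_derivable (CA k 1) Bz.
  have dP l : derivable (picard n) z (ebase l) by exact: Cn_derivable (picard_Cn n 1) Bz.
  have E k l : pd l (fun y => (A k y *m picard n y) a b) z =
      (pd l (A k) z *m picard n z + A k z *m pd l (picard n) z) a b.
    have D := derivable_mulmx (dA k l) (dP l).
    by rewrite -pd_mxE ?/pd ?(is_deriveE D)//; exact: is_derivable D.
  have -> : pd i (fun y => (A j y *m picard n y) a b) z - pd j (fun y => (A i y *m picard n y) a b) z
     = (A j z *m picard_error n i z - A i z *m picard_error n j z) a b.
    rewrite !E.
    have -> : A j z *m picard_error n i z - A i z *m picard_error n j z =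
      (pd i (A j) z *m picard n z + A j z *m pd i (picard n) z) -
      (pd j (A i) z *m picard n z + A i z *m pd j (picard n) z).
      have := integrable Bz i j => /(congr1 (fun X => X *m picard n z)).
      rewrite !mulmxBl -!mulmxA => H.
      rewrite opprD addrACA H /picard_error !mulmxBr opprB.
      by rewrite [RHS]addrACA [LHS]addrC [LHS]addrACA; congr (_ + _); exact: addrC.
    have mxB (P Q : 'M[R]_m) : (P - Q) a b = P a b - Q a b by rewrite !mxE.
    by rewrite mxB.
  apply: (le_trans (entry_le_norm _ _ _)); apply: (le_trans (ler_normB _ _)).
  by apply: lerD; apply: (le_trans (boundA _ Bz _)); rewrite ler_wpM2l//; exact: IH.
apply: (le_trans (lerD H2 H1)).
by rewrite /e exprS invfM; set p := (2 ^+ n)^-1; lra.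
Qed.

Lemma picard_limit : exists P : 'rV[R]_N -> 'M[R]_m,
  [/\ smooth_on B P, P x0 = 1%:M &
      forall x, B x -> forall i, pd i P x = A i x *m P x].
Proof.
have mxB (Q S : 'M[R]_m) a b : (Q - S) a b = Q a b - S a b by rewrite !mxE.
have H a b x : exists l, B x -> forall n, `|picard n x a b - l| <= 2 * 1 / 2 ^+ n.
  have [Bx|nBx] := pselect (B x); last by exists 0.
  have [|l Hl] := @geometric_limit _ (fun n => picard n x a b) 1; last by exists l.
  move=> n; rewrite -mxB.
  by apply: (le_trans (entry_le_norm _ _ _)); exact: picard_cauchy.
pose P x := \matrix_(a, b) sval (cid (H a b x)) : 'M[R]_m.
have HP n x a b : B x -> `|picard n x a b - P x a b| <= 2 / 2 ^+ n.
  by move=> Bx; rewrite mxE; case: cid => l /= /(_ Bx n); rewrite mulr1.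
have HPn n x : B x -> `|picard n x - P x| <= 2 / 2 ^+ n.
  move=> Bx; apply: dim_bound; first by rewrite divr_ge0// exprn_ge0.
  by move=> a b; rewrite mxB; exact: HP.
have B0 : B x0 by exact: ballxx.
have cP x : B x -> {for x, continuous P}.
  move=> Bx; apply/continuous_mxP => a b.
  apply: (@geometric_limit_continuous _ _ B (fun n y => picard n y a b) _ 2) => //.
    by move=> n y By; exact: HP.
  by move=> n; exact: Cn_continuous ((Cn_mxP _ _ oB).1 (picard_Cn n 0) a b) Bx.
have CAP0 i : Cn 0 B (fun x => A i x *m P x) by apply: Cn_mulmx => //; split.
have dP x i : B x -> is_derive x (ebase i) P (A i x *m P x).
  move=> Bx.
  have E a b : is_derive x (ebase i) (fun y => P y a b) ((A i x *m P x) a b).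
    apply: (@geometric_limit_derive _ _ B _ (fun n y => picard n y a b) _
      (fun y => (A i y *m P y) a b) (6 * C + 2)) => //.
    - move=> n y By; apply: (le_trans (HP _ _ _ _ By)).
      rewrite ler_wpM2r ?invr_ge0 ?exprn_ge0//; have := C0; lra.
    - by move=> n y By; exact: Cn_derivable ((Cn_mxP _ _ oB).1 (picard_Cn n 1) a b) By.
    - move=> n y By.
      rewrite -[X in X - _]/(pd i (fun y => picard n y a b) y) -pd_mxE; last first.
        exact: Cn_derivable (picard_Cn n 1) By.
      have -> : pd i (picard n) y a b - (A i y *m P y) a b =
          (picard_error n i y + A i y *m (picard n y - P y)) a b.
        by rewrite /picard_error mulmxBr addrA subrK mxB.
      apply: (le_trans (entry_le_norm _ _ _)); apply: (le_trans (ler_normD _ _)).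
      have K1 := picard_error_bound n i By.
      have K2 := boundA i By (picard n y - P y).
      have K3 := ler_wpM2l C0 (HPn n y By).
      have K4 : 0 <= (2 ^+ n)^-1 :> R by rewrite invr_ge0 exprn_ge0.
      by move: K1 K2 K3 K4; set p := (2 ^+ n)^-1; lra.
    - exact: Cn_continuous ((Cn_mxP _ _ oB).1 (CAP0 i) a b) Bx.
  have D : derivable P x (ebase i) by apply/derivable_mxP => a b; exact: is_derivable (E a b).
  split=> //; apply/matrixP => a b.
  by rewrite [LHS]pd_mxE//; exact: is_deriveE (E a b).
have CP n : Cn n B P.
  elim: n => [|n IH]; first by split.
  split=> // i; split=> [x Bx|]; first exact: is_derivable (dP x i Bx).
  apply: (@Cn_eq _ _ _ _ _ (fun x => A i x *m P x)) => //.
    by move=> x Bx; rewrite /pd (is_deriveE (dP x i Bx)).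
  exact: Cn_mulmx.
exists P; split.
- exact/smooth_onP.
- have p1 n : picard n x0 = 1%:M.
    case: n => // n; apply/matrixP => a b; rewrite !mxE big1 ?addr0// => j _.
    by rewrite subrr mxE mul0r.
  apply/matrixP => a b; apply/eqP; rewrite eq_sym -subr_eq0 -normr_le0.
  apply: (@le_geometric _ _ _ 2) => n.
  by rewrite add0r -(p1 n); exact: HP.
- by move=> x Bx i; rewrite /pd (is_deriveE (dP x i Bx)).
Qed.

End Picard.

Section Pfaff.
Context {R : realType} {N : nat} (x0 : 'rV[R]_N).

Lemma pd0_const r (f : 'rV[R]_N -> R) : 0 < r ->
  (forall x, ball x0 r x -> forall i, derivable f x (ebase i) /\ pd i f x = 0) ->
  forall x, ball x0 r x -> f x = f x0.
Proof.
move=> r0 H x bx; apply/eqP; rewrite -subr_eq0 -normr_le0.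
have := @box_mvt R N x0 r 0 f (fun=> 0) x0 x (lexx 0).
rewrite !mul0r big1 ?subr0 => [|i _]; last by rewrite mulr0.
apply=> //; last exact: ballxx.
by move=> z /H Hz i; have [dz ->] := Hz i; rewrite subr0 normr0.
Qed.

Lemma pd0_const_mx m p r (F : 'rV[R]_N -> 'M[R]_(m, p)) : 0 < r ->
  (forall x, ball x0 r x -> forall i, is_derive x (ebase i) F 0) ->
  forall x, ball x0 r x -> F x = F x0.
Proof.
move=> r0 H x bx; apply/matrixP => a b.
apply: (pd0_const r0 (f := fun y => F y a b)) bx => z bz i.
have D := is_derivable (H z bz i).
split; first exact: (derivable_mxP _ _ _).1.
by rewrite -pd_mxE// /pd (is_deriveE (H z bz i)) mxE.
Qed.

Lemma norm_mulmx m n p (A : 'M[R]_(m, n)) (P : 'M[R]_(n, p)) (M : R) : 0 <= M ->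
  (forall a b, `|A a b| <= M) -> `|A *m P| <= n%:R * M * `|P|.
Proof.
move=> M0 AM; apply: norm_le_entries => [|a b]; first by rewrite !mulr_ge0.
rewrite mxE (le_trans (ler_norm_sum _ _ _))//.
rewrite -mulrA mulr_natl -[X in _ *+ X]card_ord -sumr_const.
by apply: ler_sum => j _; rewrite normrM ler_pM// entry_le_norm.
Qed.

Lemma smooth_trmx m p (D : set 'rV[R]_N) (F : 'rV[R]_N -> 'M[R]_(m, p)) :
  open D -> smooth_on D F -> smooth_on D (fun x => (F x)^T).
Proof.
move=> oD sF; apply/smooth_mxP => // i j.
by under eq_fun do rewrite mxE; exact: (smooth_mxP _ oD).1.
Qed.

Lemma is_derive_trmx m p (F : 'rV[R]_N -> 'M[R]_(m, p)) x v dF :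
  is_derive x v F dF -> is_derive x v (fun x => (F x)^T) dF^T.
Proof.
move=> [D E]; have D' : derivable (fun x => (F x)^T) x v.
  apply/derivable_mxP => i j; under [X in derivable X]eq_fun do rewrite mxE.
  exact: (derivable_mxP _ _ _).1.
split=> //; rewrite derive_mx// -E derive_mx//; apply/matrixP => i j; rewrite !mxE.
by congr ('D_v _ x); apply/funext => y; rewrite mxE.
Qed.

Lemma is_derive_opp (V W : normedModType R) (F : V -> W) x v dF :
  is_derive x v F dF -> is_derive x v (fun y => - F y) (- dF).
Proof. by move=> H; exact: is_deriveN. Qed.

Lemma smooth_opp m p (D : set 'rV[R]_N) (F : 'rV[R]_N -> 'M[R]_(m, p)) :
  open D -> smooth_on D F -> smooth_on D (fun x => - F x).
Proof.
move=> oD sF; apply/smooth_onP => n; apply/Cn_mxP => // i j.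
have -> : (fun y => (- F y) i j) = (fun y => (-1) * F y i j).
  by apply/funext => y; rewrite mxE mulN1r.
apply: Cn_mul => //; first exact: Cn_cst.
exact: ((Cn_mxP _ _ oD).1 ((smooth_onP _ _).1 sF n)).
Qed.

Lemma smooth_mulmx m p q (D : set 'rV[R]_N) (F : 'rV[R]_N -> 'M[R]_(m, p))
    (G : 'rV[R]_N -> 'M[R]_(p, q)) : open D ->
  smooth_on D F -> smooth_on D G -> smooth_on D (fun x => F x *m G x).
Proof.
move=> oD /smooth_onP sF /smooth_onP sG; apply/smooth_onP => n.
exact: Cn_mulmx.
Qed.

Lemma is_derive_mulmx m p q (F : 'rV[R]_N -> 'M[R]_(m, p))
    (G : 'rV[R]_N -> 'M[R]_(p, q)) x k dF dG :
  is_derive x (ebase k) F dF -> is_derive x (ebase k) G dG ->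
  is_derive x (ebase k) (fun y => F y *m G y) (dF *m G x + F x *m dG).
Proof.
move=> [DF EF] [DG EG]; have := derivable_mulmx DF DG.
by rewrite /pd EF EG.
Qed.

Lemma smooth_is_derive (W : normedModType R) (D : set 'rV[R]_N)
    (F : 'rV[R]_N -> W) x i :
  smooth_on D F -> D x -> is_derive x (ebase i) F (pd i F x).
Proof. by move=> sF Dx; apply: derivableP; exact: smooth_derivable sF Dx. Qed.

(* Q solves the adjoint system, so that Q P has derivative zero; this gives the
   inverse of P without any uniqueness theorem. *)
Lemma pfaff m r (A : 'I_N -> 'rV[R]_N -> 'M[R]_m) : 0 < r ->
  (forall i, smooth_on (ball x0 r) (A i)) ->
  (forall x, ball x0 r x -> forall i j,
     pd i (A j) x - pd j (A i) x = A i x *m A j x - A j x *m A i x) ->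
  exists rho (P Q : 'rV[R]_N -> 'M[R]_m), [/\ 0 < rho <= r,
    smooth_on (ball x0 rho) P, smooth_on (ball x0 rho) Q,
    P x0 = 1%:M /\ Q x0 = 1%:M &
    forall x, ball x0 rho x ->
      [/\ Q x *m P x = 1%:M, forall i, is_derive x (ebase i) P (A i x *m P x) &
          forall i, is_derive x (ebase i) Q (- (Q x *m A i x))]].
Proof.
move=> r0 sA intA; have oB : open (ball x0 r) by exact: ball_open.
have r2 : 0 < r / 2 by lra.
have r2r : r / 2 < r by lra.
have /choice[Mf HMf] : forall iab : 'I_N * 'I_m * 'I_m, exists M, 0 <= M /\
    forall x, ball x0 (r / 2) x -> `|A iab.1.1 x iab.1.2 iab.2| <= M.
  move=> [[i a] b] /=.
  have [|M] := @bounded_on_smaller_ball _ _ x0 r (r / 2) (fun x => A i x a b) r2 r2r.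
    by move=> x; apply: smooth_continuous; exact: (smooth_mxP _ oB).1.
  by exists M.
pose M := \sum_i Mf i.
have M0 : 0 <= M by apply: sumr_ge0 => i _; case: (HMf i).
have AM i x a b : ball x0 (r / 2) x -> `|A i x a b| <= M.
  move=> bx; apply: (le_trans ((HMf (i, a, b)).2 x bx)).
  by rewrite /M (bigD1 (i, a, b))//= lerDl sumr_ge0// => j _; case: (HMf j).
pose C := m%:R * M.
have C0 : 0 <= C by rewrite mulr_ge0.
have K0 : 0 < 8 * (N%:R * C + 1) by rewrite mulr_gt0// ltr_wpDl// mulr_ge0.
pose rho := Num.min (r / 2) (8 * (N%:R * C + 1))^-1.
have rho0 : 0 < rho by rewrite lt_min r2 invr_gt0 K0.
have rho2 : rho <= r / 2 by rewrite ge_min lexx.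
have rhor : rho <= r by rewrite (le_trans rho2)// ltW.
have small : N%:R * rho * C <= 8^-1.
  rewrite mulrAC; apply: (@le_trans _ _ (N%:R * C * (8 * (N%:R * C + 1))^-1)).
    by rewrite ler_wpM2l ?mulr_ge0// ge_min lexx orbT.
  by rewrite ler_pdivrMr//; set c := N%:R * C; lra.
have sub : ball x0 rho `<=` ball x0 r by exact: ballW.
have oBr : open (ball x0 rho) by exact: ball_open.
have sAr i : smooth_on (ball x0 rho) (A i) by exact: smooth_sub (sA i).
have [||P [sP P0 dP]] := @picard_limit R N m x0 rho C A rho0 C0 sAr _ small.
- by move=> i x bx P; apply: norm_mulmx => // a b; apply: AM; exact: ballW bx.
- by move=> x bx i j; apply: intA; exact: sub.
pose A' i x := - (A i x)^T.
have sA' i : smooth_on (ball x0 rho) (A' i).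
  exact: (smooth_opp oBr (smooth_trmx oBr (sAr i))).
have dA' i j x : ball x0 rho x -> is_derive x (ebase i) (A' j) (- (pd i (A j) x)^T).
  by move=> bx; exact: (is_derive_opp (is_derive_trmx (smooth_is_derive i (sAr j) bx))).
have [||Q' [sQ' Q0 dQ']] := @picard_limit R N m x0 rho C A' rho0 C0 sA' _ small.
- move=> i x bx P'; apply: norm_mulmx => // a b; rewrite !mxE normrN.
  by apply: AM; exact: ballW bx.
- move=> x bx i j; rewrite /pd (is_deriveE (dA' i j x bx)) (is_deriveE (dA' j i x bx)).
  rewrite /A' !mulNmx !mulmxN !opprK -!trmx_mul [LHS]addrC -!linearB/=.
  by rewrite (intA x (sub _ bx) j i).
pose Q x := (Q' x)^T.
have sQ : smooth_on (ball x0 rho) Q by exact: (smooth_trmx oBr sQ').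
have dPi x i : ball x0 rho x -> is_derive x (ebase i) P (A i x *m P x).
  by move=> bx; rewrite -dP//; exact: smooth_is_derive sP bx.
have dQi x i : ball x0 rho x -> is_derive x (ebase i) Q (- (Q x *m A i x)).
  move=> bx; have -> : - (Q x *m A i x) = (A' i x *m Q' x)^T.
    by rewrite trmx_mul /A' linearN/= trmxK mulmxN.
  by apply: is_derive_trmx; rewrite -dQ'//; exact: smooth_is_derive sQ' bx.
exists rho, P, Q; split => //; first by rewrite rho0.
  by split=> //; rewrite /Q Q0 trmx1.
move=> x bx; split=> [|i|i]; [|exact: dPi|exact: dQi].
have QP0 : Q x0 *m P x0 = 1%:M by rewrite P0 /Q Q0 trmx1 mulmx1.
rewrite -QP0; apply: (pd0_const_mx rho0 (F := fun x => Q x *m P x)) bx => z bz i.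
have := is_derive_mulmx (dQi z i bz) (dPi z i bz).
by rewrite mulmxA mulNmx addNr.
Qed.

End Pfaff.

(** * Inverse functions *)

Section InverseFunction.
Context {R : realType} {N : nat} (x0 : 'rV[R]_N).

Lemma near_identity r (phi : 'rV[R]_N -> 'rV[R]_N) : 0 < r ->
  Cn 1 (ball x0 r) phi -> (forall i, pd i phi x0 = ebase i) ->
  exists2 rho, 0 < rho < r & forall x y, ball x0 rho x -> ball x0 rho y ->
    `|phi y - phi x - (y - x)| <= 2^-1 * `|y - x|.
Proof.
move=> r0 Cphi dphi0; have oB : open (ball x0 r) by exact: ball_open.
have B0 : ball x0 r x0 by exact: ballxx.
pose e : R := (2 * N.+1%:R)^-1.
have e0 : 0 < e by rewrite invr_gt0 mulr_gt0.
have Ck k : Cn 1 (ball x0 r) (fun y => phi y 0 k) by exact: (Cn_mxP _ _ oB).1.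
have H : \forall x \near x0, forall ik : 'I_N * 'I_N,
    `|pd ik.1 (fun y => phi y 0 ik.2) x - (ik.1 == ik.2)%:R| <= e.
  near=> x => ik; move: ik; near: x; apply: filter_forall => -[i k]/=.
  have := Cn_continuous (Cn_pd i (Ck k)) B0.
  move=> /cvgrPdist_le/(_ _ e0); apply: filterS => x.
  rewrite -pd_mxE; last exact: Cn_derivable Cphi B0.
  by rewrite dphi0 distrC mxE eqxx/= eq_sym.
have [rho1 /= rho10 H1] := (nbhs_ballP _ _).1 H.
pose rho := Num.min rho1 (r / 2).
have rho0 : 0 < rho by rewrite lt_min rho10; lra.
have rhor : rho < r by apply: (@le_lt_trans _ _ (r / 2)); [rewrite ge_min lexx orbT|lra].
exists rho; first by rewrite rho0.
move=> x y bx yb; apply: norm_le_entries => [|a k]; first by rewrite mulr_ge0.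
rewrite ord1 {a} !mxE.
have HB : forall z, ball x0 rho z -> forall i,
    derivable (fun y => phi y 0 k) z (ebase i) /\
    `|pd i (fun y => phi y 0 k) z - (i == k)%:R| <= e.
  move=> z bz i; split.
    by apply: Cn_derivable (Ck k) _; exact: ballW (ltW rhor) _ bz.
  by apply: (H1 z _ (i, k)); apply: ballW bz; rewrite ge_min lexx.
have := box_mvt (ltW e0) HB bx yb.
rewrite (bigD1 k)//= eqxx mulr1 big1 ?addr0 => [|i /negbTE ->]; last by rewrite mulr0.
rewrite !mxE => /le_trans; apply; rewrite ler_wpM2r// /e invfM.
by rewrite -[leRHS]mulr1 -mulrA ler_wpM2l// ler_pdivrMl// mulr1 ler_nat.
Unshelve. all: by end_near. Qed.

Lemma geometric_limit_mx m p (u : nat -> 'M[R]_(m, p)) (c : R) : 0 <= c ->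
  (forall n, `|u n.+1 - u n| <= c / 2 ^+ n) ->
  exists l, forall n, `|u n - l| <= 2 * c / 2 ^+ n.
Proof.
move=> c0 H.
have mxB (P Q : 'M[R]_(m, p)) a b : (P - Q) a b = P a b - Q a b by rewrite !mxE.
have E a b : exists l, forall n, `|u n a b - l| <= 2 * c / 2 ^+ n.
  apply: geometric_limit => n; rewrite -mxB.
  exact: le_trans (entry_le_norm _ _ _) (H n).
exists (\matrix_(a, b) sval (cid (E a b))) => n.
apply: norm_le_entries => [|a b]; first by rewrite divr_ge0 ?mulr_ge0// exprn_ge0.
by rewrite mxB mxE; case: cid.
Qed.

Lemma near_identity_inj rho (phi : 'rV[R]_N -> 'rV[R]_N) :
  (forall x y, ball x0 rho x -> ball x0 rho y ->
    `|phi y - phi x - (y - x)| <= 2^-1 * `|y - x|) ->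
  forall x y, ball x0 rho x -> ball x0 rho y -> `|y - x| <= 2 * `|phi y - phi x|.
Proof.
move=> H x y bx yb; have K := H x y bx yb.
have := ler_normB (phi y - phi x) (phi y - phi x - (y - x)).
by rewrite subKr; lra.
Qed.

(* Fixed point of [x |-> x - phi x + y]. *)
Lemma near_identity_surj rho (phi : 'rV[R]_N -> 'rV[R]_N) : 0 < rho ->
  (forall x y, ball x0 rho x -> ball x0 rho y ->
    `|phi y - phi x - (y - x)| <= 2^-1 * `|y - x|) ->
  forall y, ball (phi x0) (rho / 4) y -> exists2 x, ball x0 rho x & phi x = y.
Proof.
move=> rho0 H y /ball_normP by0.
have cB (x : 'rV[R]_N) : `|x - x0| <= rho / 2 -> ball x0 rho x.
  by move=> h; apply/ball_normP; rewrite distrC; lra.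
have B0 : ball x0 rho x0 by exact: ballxx.
pose T x := x - phi x + y.
pose u n := iter n T x0.
have uS n : u n.+1 = u n - phi (u n) + y by [].
have ub n : `|u n - x0| <= rho / 2.
  elim: n => [|n IH]; first by rewrite subrr normr0; lra.
  have K := H _ _ B0 (cB _ IH).
  have -> : u n.+1 - x0 = - (phi (u n) - phi x0 - (u n - x0)) - (phi x0 - y).
    by rewrite uS; apply/rowP => j; rewrite !mxE; ring.
  have := ler_normB (- (phi (u n) - phi x0 - (u n - x0))) (phi x0 - y).
  rewrite normrN; lra.
have us n : `|u n.+1 - u n| <= (rho / 4) / 2 ^+ n.
  elim: n => [|n IH].
    have -> : u 1 - u 0 = y - phi x0.
      by rewrite uS; apply/rowP => j; rewrite !mxE; ring.
    by rewrite expr0 divr1 distrC; exact: ltW.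
  have -> : u n.+2 - u n.+1 = - (phi (u n.+1) - phi (u n) - (u n.+1 - u n)).
    by rewrite !uS; apply/rowP => j; rewrite !mxE; ring.
  rewrite normrN; apply: (le_trans (H _ _ (cB _ (ub n)) (cB _ (ub n.+1)))).
  rewrite exprS invfM; move: IH; set p := (2 ^+ n)^-1; lra.
have r4 : 0 <= rho / 4 by lra.
have [l Hl] := geometric_limit_mx r4 us.
have bl : ball x0 rho l.
  apply: cB; apply: (@le_geometric _ _ _ (2 * (rho / 4))) => n.
  have := ler_normB (u n - x0) (u n - l).
  rewrite [X in `|X| <= _](_ : _ = l - x0); last by rewrite opprB addrC subrKA.
  have := ub n; have := Hl n; lra.
exists l => //; apply/eqP; rewrite -subr_eq0 -normr_le0.
apply: (@le_geometric _ _ _ (4 * rho)) => n; rewrite add0r.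
have K1 := H _ _ (cB _ (ub n)) bl; have K2 := Hl n; have K3 := us n.
have -> : phi l - y = (phi l - phi (u n) - (l - u n)) - (u n - l) - (u n.+1 - u n).
  by rewrite uS; apply/rowP => j; rewrite !mxE; ring.
have K4 := ler_normB ((phi l - phi (u n) - (l - u n)) - (u n - l)) (u n.+1 - u n).
have K5 := ler_normB (phi l - phi (u n) - (l - u n)) (u n - l).
have K6 : `|l - u n| = `|u n - l| by rewrite distrC.
move: K1 K2 K3 K4 K5; rewrite K6; set p := (2 ^+ n)^-1.
have p0 : 0 <= p by rewrite invr_ge0 exprn_ge0.
have : 0 <= rho * p by rewrite mulr_ge0// ltW.
lra.
Qed.

End InverseFunction.

Section InverseFunctionTheorem.
Context {R : realType} {N : nat} (x0 : 'rV[R]_N).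

Lemma mulmx_rV_linear p (Q : 'M[R]_(N, p)) :
  exists L : {linear 'rV[R]_N -> 'rV[R]_p},
    continuous L /\ forall v, L v = v *m Q.
Proof.
exists (mulmxr Q); split=> // v.
have : Cn 0 setT (fun v : 'rV[R]_N => v *m Q).
  apply: Cn_mulmx; [exact: openT| |exact: Cn_cst].
  by split=> // x _; exact: cvg_id.
by move=> /Cn_continuous; exact.
Qed.

Lemma inverse_function r (phi : 'rV[R]_N -> 'rV[R]_N) (P Q : 'rV[R]_N -> 'M[R]_N) :
  0 < r -> smooth_on (ball x0 r) phi -> smooth_on (ball x0 r) Q ->
  P x0 = 1%:M ->
  (forall x, ball x0 r x -> Q x *m P x = 1%:M /\ forall i, pd i phi x = row i (P x)) ->
  exists (delta : R) (V : set 'rV[R]_N) (theta : 'rV[R]_N -> 'rV[R]_N),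
    [/\ 0 < delta, open V /\ V x0, V `<=` ball x0 r,
        forall x, V x -> ball (phi x0) delta (phi x) /\ theta (phi x) = x &
        smooth_on (ball (phi x0) delta) theta /\
        forall y, ball (phi x0) delta y -> [/\ V (theta y), phi (theta y) = y &
          forall v, is_derive y v theta (v *m Q (theta y))]].
Proof.
move=> r0 sphi sQ P0 HP; have oB : open (ball x0 r) by exact: ball_open.
have B0 : ball x0 r x0 by exact: ballxx.
have Cphi n : Cn n (ball x0 r) phi by exact: (smooth_onP _ _).1.
have [|rho /andP[rho0 rhor] H] := near_identity r0 (Cphi 1%N).
  by move=> i; rewrite (HP _ B0).2 P0 rowE mulmx1.
have inj := near_identity_inj H.
have surj := near_identity_surj rho0 H.
pose delta := rho / 4; have delta0 : 0 < delta by rewrite /delta; lra.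
have sub : ball x0 rho `<=` ball x0 r by exact: ballW (ltW rhor).
have Hth y : exists x, ball (phi x0) delta y -> ball x0 rho x /\ phi x = y.
  have [yb|nyb] := pselect (ball (phi x0) delta y); last by exists x0.
  by have [x bx <-] := surj y yb; exists x.
have /choice[theta Ht] := Hth.
pose V := [set x | ball x0 rho x /\ ball (phi x0) delta (phi x)].
have oV : open V.
  rewrite openE => x [bx bphi]; apply: filterI.
    by apply: open_nbhs_nbhs; split=> //; exact: ball_open.
  have := Cn_continuous (Cphi 0%N) (sub _ bx); apply.
  by apply: open_nbhs_nbhs; split=> //; exact: ball_open.
have thphi x : V x -> theta (phi x) = x.
  move=> [bx bphi]; have [bt E] := Ht _ bphi.
  have := inj _ _ bt bx; rewrite E subrr normr0 mulr0 normr_le0 subr_eq0.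
  by move=> /eqP.
have lip y z : ball (phi x0) delta y -> ball (phi x0) delta z ->
    `|theta z - theta y| <= 2 * `|z - y|.
  move=> yb zb; have [by1 E1] := Ht _ yb; have [bz1 E2] := Ht _ zb.
  by have := inj _ _ by1 bz1; rewrite E1 E2.
have oD : open (ball (phi x0) delta) by exact: ball_open.
have cth y : ball (phi x0) delta y -> {for y, continuous theta}.
  move=> yb; apply/continuous_mxP => a k.
  apply: (@lipschitz_continuous _ _ _ _ 2).
  apply: (open_near oD yb) => z zb.
  rewrite -[X in `|X|](_ : (theta z - theta y) a k = _); last by rewrite !mxE.
  exact: le_trans (entry_le_norm _ _ _) (lip _ _ yb zb).
have dth y v : ball (phi x0) delta y -> is_derive y v theta (v *m Q (theta y)).
  move=> yb; have [bx E] := Ht _ yb; set x := theta y in bx E *.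
  have [QP dphi] := HP _ (sub _ bx).
  have PQ : P x *m Q x = 1%:M by exact: mulmx1C.
  have [L [cL LE]] := mulmx_rV_linear (Q x).
  have [|dt dE] := @is_diff_near _ _ _ theta L y cL.
    move=> e e0.
    pose K := N%:R * `|Q x| + 1.
    have K0 : 0 < K by rewrite ltr_wpDl// mulr_ge0.
    have e'0 : 0 < e / (2 * K) by rewrite divr_gt0// mulr_gt0.
    have A1 : \forall x' \near x, forall k, `|phi x' 0 k - phi x 0 k -
        \sum_i (x' - x) 0 i * pd i (fun y => phi y 0 k) x| <= e / (2 * K) * `|x' - x|.
      near=> x' => k; move: k; near: x'; apply: filter_forall => k.
      apply: (C1_approx oB (sub _ bx) _ e'0).
      exact: ((Cn_mxP _ _ oB).1 (Cphi 1%N)).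
    have A2 : \forall z \near y, forall k, `|phi (theta z) 0 k - phi x 0 k -
        \sum_i (theta z - x) 0 i * pd i (fun y => phi y 0 k) x| <= e / (2 * K) * `|theta z - x|.
      exact: (cth y yb _ A1).
    have A3 : \forall z \near y, ball (phi x0) delta z by exact: (open_near oD yb).
    apply: filterS2 A2 A3 => z Hz zb.
    have [_ Ez] := Ht _ zb.
    rewrite LE -/x.
    have -> : theta z - x - (z - y) *m Q x =
        - ((phi (theta z) - phi x - (theta z - x) *m P x) *m Q x).
      by rewrite Ez E [in RHS]mulmxBl -mulmxA PQ mulmx1 opprB.
    rewrite normrN.
    have N1 : `|phi (theta z) - phi x - (theta z - x) *m P x| <= e / (2 * K) * `|theta z - x|.
      apply: norm_le_entries => [|a k]; first by rewrite mulr_ge0// ltW.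
      rewrite ord1 {a}; have mxB (s t : 'rV[R]_N) : (s - t) 0 k = s 0 k - t 0 k by rewrite !mxE.
      rewrite mxB mxB [X in _ - _ - X]mxE.
      under eq_bigr => i _.
        rewrite (_ : P x i k = pd i (fun y => phi y 0 k) x); last first.
          rewrite -pd_mxE ?dphi ?mxE//.
          by apply: Cn_derivable (Cphi 1%N) _; exact: sub.
        over.
      exact: Hz.
    have N2 : `|(phi (theta z) - phi x - (theta z - x) *m P x) *m Q x| <=
        N%:R * `|phi (theta z) - phi x - (theta z - x) *m P x| * `|Q x|.
      by apply: norm_mulmx => // a b; exact: entry_le_norm.
    apply: (le_trans N2).
    have N3 := lip _ _ yb zb; rewrite -/x in N3.
    apply: (@le_trans _ _ (K * (e / (2 * K) * (2 * `|z - y|)))).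
      rewrite mulrAC ler_pM ?mulr_ge0//; first by rewrite /K lerDl.
      apply: (le_trans N1); rewrite ler_wpM2l//; exact: ltW.
    by rewrite le_eqVlt; apply/orP; left; apply/eqP; field; rewrite gt_eqF.
  split; first exact: diff_derivable.
  by rewrite deriveE// dE LE.
have CT n : Cn n (ball (phi x0) delta) theta.
  elim: n => [|n IH]; first by split.
  split=> // i; split=> [y yb|]; first exact: is_derivable (dth y _ yb).
  apply: (@Cn_eq _ _ _ _ _ (fun y => ebase i *m Q (theta y))) => //.
    by move=> y yb; rewrite /pd (is_deriveE (dth y (ebase i) yb)).
  apply: Cn_mulmx => //; first exact: Cn_cst.
  apply/Cn_mxP => // a b.
  apply: (@Cn_comp _ _ _ _ _ (ball x0 r) (fun x => Q x a b) theta) => //.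
    by move=> y yb; apply: sub; exact: (Ht _ yb).1.
  exact: ((Cn_mxP _ _ oB).1 ((smooth_onP _ _).1 sQ n)).
exists delta, V, theta; split=> //.
- by split=> //; split; exact: ballxx.
- by move=> x [/sub].
- by move=> x Vx; split; [exact: Vx.2|exact: thphi].
- split; first exact/smooth_onP.
  move=> y yb; have [bt E] := Ht _ yb.
  by split=> //; [split=> //; rewrite E|move=> v; exact: dth].
Unshelve. all: by end_near. Qed.

End InverseFunctionTheorem.

(** * Flat charts *)

Section Charts.
Context {R : realType} {N : nat}.

Lemma overlap_open (M : topologicalType) (a b : chart R N M) : open (overlap a b).
Proof.
rewrite openE => x [cx dx]; apply: filterI.
  by apply: open_nbhs_nbhs; split=> //; exact: chart_cod_open.
apply: (chart_inv_cts cx).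
by apply: open_nbhs_nbhs; split=> //; exact: chart_dom_open.
Qed.

Lemma chart_diffeo (M : smoothManifold R N) (a : chart R N M)
    (V W : set 'rV[R]_N) (phi theta : 'rV[R]_N -> 'rV[R]_N) :
  atlas a -> open V -> open W -> V `<=` chart_cod a ->
  (forall x, V x -> W (phi x) /\ theta (phi x) = x) ->
  (forall y, W y -> V (theta y) /\ phi (theta y) = y) ->
  smooth_on V phi -> smooth_on W theta ->
  exists b : chart R N M, [/\ atlas b, chart_cod b = W,
    chart_dom b = [set p | chart_dom a p /\ V (chart_map a p)],
    chart_map b = phi \o chart_map a & chart_inv b = chart_inv a \o theta].
Proof.
move=> Aa oV oW Vsub phiP thP sphi sth.
pose dom := [set p | chart_dom a p /\ V (chart_map a p)].
have odom : open dom.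
  rewrite openE => p [dp Vp]; apply: filterI.
    by apply: open_nbhs_nbhs; split=> //; exact: chart_dom_open.
  by apply: (chart_map_cts dp); exact: open_nbhs_nbhs.
have h1 p : dom p -> W ((phi \o chart_map a) p) by move=> [_ /phiP[]].
have mapK y : W y -> chart_map a (chart_inv a (theta y)) = theta y.
  by move=> /thP[/Vsub/chart_invK].
have h2 y : W y -> dom ((chart_inv a \o theta) y).
  move=> Wy; split=> /=; last by rewrite mapK//; case: (thP _ Wy).
  by apply: chart_inv_in; apply: Vsub; case: (thP _ Wy).
have h3 p : dom p -> (chart_inv a \o theta) ((phi \o chart_map a) p) = p.
  by move=> [dp Vp] /=; rewrite (phiP _ Vp).2 chart_mapK.
have h4 y : W y -> (phi \o chart_map a) ((chart_inv a \o theta) y) = y.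
  by move=> Wy /=; rewrite mapK// (thP _ Wy).2.
have h5 p : dom p -> {for p, continuous (phi \o chart_map a)}.
  move=> [dp Vp]; apply: continuous_comp; first exact: chart_map_cts.
  exact: smooth_continuous sphi Vp.
have h6 y : W y -> {for y, continuous (chart_inv a \o theta)}.
  move=> Wy; apply: continuous_comp; first exact: smooth_continuous sth Wy.
  by apply: chart_inv_cts; apply: Vsub; case: (thP _ Wy).
pose b := Chart odom oW h1 h2 h3 h4 h5 h6.
exists b; split=> //; apply: atlas_maximal => c Ac.
have [ac ca] := atlas_compatible Aa Ac; split.
- apply: (@smooth_comp _ _ _ _ _ (overlap b c) (overlap a c) (transition a c) theta) => //.
  + exact: overlap_open.
  + exact: overlap_open.
  + move=> y [Wy dy]; split=> //; apply: Vsub; case: (thP _ Wy) => //.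
  + by apply: smooth_sub sth => y [].
- apply: (@smooth_comp _ _ _ _ _ (overlap c b) V phi (transition c a)) => //.
  + exact: overlap_open.
  + by move=> x [_ [_]].
  + by apply: smooth_sub ca => x [cx [dx _]].
Qed.

End Charts.

Section SmoothOperations.
Context {R : realType} {N : nat}.
Implicit Types (D : set 'rV[R]_N).

Lemma Cn_prod n D (I : Type) (r : seq I) (P : pred I) (F : I -> 'rV[R]_N -> R) :
  open D -> (forall i, P i -> Cn n D (F i)) ->
  Cn n D (fun x => \prod_(i <- r | P i) F i x).
Proof.
move=> oD CF; elim: r => [|i r IH].
  by under eq_fun do rewrite big_nil; exact: Cn_cst.
case Pi: (P i); last by under eq_fun do rewrite big_cons Pi.
by under eq_fun do rewrite big_cons Pi; apply: Cn_mul => //; exact: CF.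
Qed.

Lemma Cn_inv n D (f : 'rV[R]_N -> R) : open D -> (forall x, D x -> f x != 0) ->
  Cn n D f -> Cn n D (fun x => (f x)^-1).
Proof.
move=> oD f0; elim: n => [|n IH] Cf.
  split=> // x Dx; apply: continuousV; first exact: f0.
  exact: Cn_continuous Cf Dx.
have df x i : D x -> is_derive x (ebase i) (fun x => (f x)^-1) (- ((f x)^-1 * (f x)^-1 * pd i f x)).
  move=> Dx; have Df := Cn_derivable (i := i) Cf Dx.
  split; first exact: derivableV (f0 x Dx) Df.
  rewrite (deriveV (f0 x Dx) Df) scaleNr /GRing.scale/= -/(pd i f x).
  by rewrite -expr2 exprVn.
split=> [x Dx|i].
  apply: continuousV; first exact: f0.
  exact: Cn_continuous Cf Dx.
split=> [x Dx|]; first exact: is_derivable (df x i Dx).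
apply: (@Cn_eq _ _ _ _ _ (fun x => (-1) * ((f x)^-1 * (f x)^-1 * pd i f x))) => //.
  by move=> x Dx; rewrite /pd (is_deriveE (df x i Dx)) mulN1r.
have CI := IH (Cn_pred Cf).
apply: Cn_mul => //; first exact: Cn_cst.
by apply: Cn_mul => //; [exact: Cn_mul|exact: Cn_pd].
Qed.

Lemma Cn_det n D m (F : 'rV[R]_N -> 'M[R]_m) : open D ->
  (forall i j, Cn n D (fun x => F x i j)) -> Cn n D (fun x => \det (F x)).
Proof.
move=> oD CF; apply: Cn_sum => // s _; apply: Cn_mul => //; first exact: Cn_cst.
exact: Cn_prod.
Qed.

Lemma smooth_invmx D m (F : 'rV[R]_N -> 'M[R]_m) : open D ->
  (forall x, D x -> F x \in unitmx) -> smooth_on D F ->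
  smooth_on D (fun x => invmx (F x)).
Proof.
move=> oD uF /smooth_onP sF; apply/smooth_onP => n.
apply/Cn_mxP => // i j.
apply: (@Cn_eq _ _ _ _ _ (fun x => (\det (F x))^-1 * cofactor (F x) j i)) => //.
  by move=> x Dx; rewrite /invmx uF// !mxE.
have CF a b : Cn n D (fun x => F x a b) by exact: (Cn_mxP _ _ oD).1.
apply: Cn_mul => //.
  apply: Cn_inv => //; last exact: Cn_det.
  by move=> x Dx; rewrite -unitfE -unitmxE uF.
apply: Cn_mul => //; first exact: Cn_cst.
by apply: Cn_det => // a b; under eq_fun do rewrite !mxE.
Qed.

Lemma smoothM D (f g : 'rV[R]_N -> R) : open D ->
  smooth_on D f -> smooth_on D g -> smooth_on D (fun x => f x * g x).
Proof.
by move=> oD /smooth_onP sf /smooth_onP sg; apply/smooth_onP => n; exact: Cn_mul.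
Qed.

Lemma smoothD D (W : normedModType R) (f g : 'rV[R]_N -> W) : open D ->
  smooth_on D f -> smooth_on D g -> smooth_on D (fun x => f x + g x).
Proof.
by move=> oD /smooth_onP sf /smooth_onP sg; apply/smooth_onP => n; exact: Cn_add.
Qed.

Lemma smooth_sum D (I : Type) (r : seq I) (F : I -> 'rV[R]_N -> R) : open D ->
  (forall i, smooth_on D (F i)) -> smooth_on D (fun x => \sum_(i <- r) F i x).
Proof.
move=> oD sF; apply/smooth_onP => n; apply: Cn_sum => // i _.
exact: (smooth_onP _ _).1.
Qed.

Lemma bilin_ebase (Q : 'M[R]_N) i j : bilin Q (ebase i) (ebase j) = Q i j.
Proof. by rewrite /bilin /ebase -rowE trmx_delta -colE !mxE. Qed.

Lemma poincare_rV p (x0 : 'rV[R]_N) r (a : 'I_N -> 'rV[R]_N -> 'rV[R]_p) : 0 < r ->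
  (forall i, smooth_on (ball x0 r) (a i)) ->
  (forall x, ball x0 r x -> forall i j, pd i (a j) x = pd j (a i) x) ->
  exists f, smooth_on (ball x0 r) f /\
    forall x, ball x0 r x -> forall i, pd i f x = a i x.
Proof.
move=> r0 sa sym; have oB : open (ball x0 r) by exact: ball_open.
have sac i k : smooth_on (ball x0 r) (fun x => a i x 0 k) by exact: (smooth_mxP _ oB).1.
have /choice[f Hf] : forall k, exists f, [/\ smooth_on (ball x0 r) f, f x0 = 0 &
    forall x, ball x0 r x -> forall i, pd i f x = a i x 0 k].
  move=> k; apply: (@poincare R N x0 r (fun i x => a i x 0 k) r0) => // x bx i j.
  have E u v : pd u (fun x => a v x 0 k) x = pd u (a v) x 0 k.
    by rewrite pd_mxE//; exact: smooth_derivable (sa v) bx.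
  by rewrite !E sym.
pose F x := \row_k f k x.
have sF : smooth_on (ball x0 r) F.
  apply/smooth_mxP => // i k; under eq_fun do rewrite mxE.
  by case: (Hf k).
exists F; split=> // x bx i; apply/rowP => k.
rewrite pd_mxE; last exact: smooth_derivable sF bx.
under [X in pd i X]eq_fun do rewrite mxE.
by case: (Hf k) => _ _ ->.
Qed.

End SmoothOperations.

Section FlatMetric.
Context {R : realType} {N : nat} (D : set 'rV[R]_N) (g : 'rV[R]_N -> 'M[R]_N).
Hypotheses (oD : open D) (sg : smooth_on D g).
Hypothesis gsym : forall x, D x -> (g x)^T = g x.
Hypothesis gunit : forall x, D x -> g x \in unitmx.

Let pdg_entry k x i j : D x -> pd k g x i j = pd k (fun y => g y i j) x.
Proof. by move=> Dx; rewrite pd_mxE//; exact: smooth_derivable sg Dx. Qed.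

Let gsymE x i j : D x -> g x i j = g x j i.
Proof. by move=> Dx; rewrite -{1}gsym// mxE. Qed.

Let pdg_sym k x i j : D x -> pd k g x i j = pd k g x j i.
Proof.
by move=> Dx; rewrite !pdg_entry//; apply: pd_eq (Dx) => // y Dy; exact: gsymE.
Qed.

Lemma christoffel_sym k i j x : D x -> christoffel g k i j x = christoffel g k j i x.
Proof.
move=> Dx; congr (_ * _); apply: eq_bigr => l _; congr (_ * _).
by congr (_ - _); [exact: addrC|exact: pdg_sym].
Qed.

Lemma christoffel_smooth k i j : smooth_on D (christoffel g k i j).
Proof.
apply: smoothM => //; first exact: smooth_cst.
apply: smooth_sum => // l; apply: smoothM => //.
  by apply: (smooth_mxP _ oD).1; exact: smooth_invmx.
have sp a b c : smooth_on D (fun x => pd a g x b c).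
  by apply: (smooth_mxP _ oD).1; exact: smooth_pd.
apply: smoothD => //; first exact: smoothD.
apply: (@smooth_eq _ _ _ _ (fun x => (-1) * pd l g x i j)) => //.
  by move=> x _; rewrite mulN1r.
by apply: smoothM => //; exact: smooth_cst.
Qed.

Lemma christoffel_lower k i j x : D x ->
  \sum_m christoffel g m i j x * g x m k =
  2^-1 * (pd i g x k j + pd j g x k i - pd k g x i j).
Proof.
move=> Dx; pose c l := pd i g x l j + pd j g x l i - pd l g x i j.
rewrite -[X in _ = _ * X]/(c k) /christoffel.
under eq_bigr do rewrite -mulrA mulr_suml.
rewrite -mulr_sumr exchange_big/=; congr (_ * _).
under eq_bigr => l _.
  under eq_bigr do rewrite mulrAC.
  rewrite -mulr_suml (_ : \sum_m _ = (l == k)%:R); last first.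
    have := mulmxV (gunit Dx) => /(congr1 (fun A : 'M_N => A k l)).
    rewrite !mxE eq_sym => <-; apply: eq_bigr => m _.
    by rewrite mulrC (gsymE _ _ Dx).
  over.
rewrite (bigD1 k)//= eqxx mul1r big1 ?addr0// => l /negbTE ->.
by rewrite mul0r.
Qed.

Definition christoffel_mx i x : 'M[R]_N := \matrix_(j, k) christoffel g k i j x.

Lemma christoffel_mx_smooth i : smooth_on D (christoffel_mx i).
Proof.
apply: (smooth_mxP _ oD).2 => j k.
have -> : (fun y => christoffel_mx i y j k) = christoffel g k i j.
  by apply/funext => y; rewrite mxE.
exact: christoffel_smooth.
Qed.

Lemma metric_compat i x : D x ->
  pd i g x = christoffel_mx i x *m g x + g x *m (christoffel_mx i x)^T.
Proof.
move=> Dx; apply/matrixP => j k; rewrite mxE.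
have -> : (christoffel_mx i x *m g x) j k = 2^-1 * (pd i g x k j + pd j g x k i - pd k g x i j).
  by rewrite -christoffel_lower// mxE; apply: eq_bigr => m _; rewrite !mxE.
have -> : (g x *m (christoffel_mx i x)^T) j k = 2^-1 * (pd i g x j k + pd k g x j i - pd j g x i k).
  rewrite -christoffel_lower// mxE; apply: eq_bigr => m _; rewrite !mxE mulrC.
  by rewrite (gsymE _ _ Dx).
have key (G : 'I_N -> 'I_N -> 'I_N -> R) : (forall a b c, G a b c = G a c b) ->
    G i j k = 2^-1 * (G i k j + G j k i - G k i j) + 2^-1 * (G i j k + G k j i - G j i k).
  by move=> Gs; rewrite (Gs i k j) (Gs j k i) (Gs k i j); lra.
exact: (key (fun a b c => pd a g x b c) (fun a b c => pdg_sym a b c Dx)).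
Qed.

Lemma christoffel_mx_integrable i j x : D x -> flat_metric D g ->
  pd i (christoffel_mx j) x - pd j (christoffel_mx i) x =
  christoffel_mx i x *m christoffel_mx j x - christoffel_mx j x *m christoffel_mx i x.
Proof.
move=> Dx flat; apply/matrixP => k l.
have cE b : (fun y => christoffel_mx b y k l) = christoffel g l b k.
  by apply/funext => y; rewrite mxE.
have dE a b : pd a (christoffel_mx b) x k l = pd a (christoffel g l b k) x.
  by rewrite pd_mxE ?cE//; exact: smooth_derivable (christoffel_mx_smooth b) Dx.
have mxB (A B : 'M[R]_N) : (A - B) k l = A k l - B k l by rewrite !mxE.
have mE a b : (christoffel_mx a x *m christoffel_mx b x) k l =
    \sum_m christoffel g l b m x * christoffel g m a k x.
  by rewrite mxE; apply: eq_bigr => m _; rewrite !mxE mulrC.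
have alg (a b s t : R) : a - b + (s - t) = 0 -> a - b = t - s by lra.
rewrite mxB (dE i j) (dE j i) mxB (mE i j) (mE j i); apply: alg.
by rewrite -sumrB; exact: flat x Dx l k i j.
Qed.

End FlatMetric.

Section FlatCoordinates.
Context {R : realType} {N : nat}.

Lemma flat_coordinates (D : set 'rV[R]_N) (g : 'rV[R]_N -> 'M[R]_N) x0 :
  open D -> D x0 -> smooth_on D g -> (forall x, D x -> (g x)^T = g x) ->
  (forall x, D x -> g x \in unitmx) -> flat_metric D g ->
  exists (delta : R) (V : set 'rV[R]_N) (phi theta : 'rV[R]_N -> 'rV[R]_N),
    [/\ 0 < delta, [/\ open V, V x0 & V `<=` D],
        smooth_on V phi /\ smooth_on (ball (phi x0) delta) theta,
        forall x, V x -> ball (phi x0) delta (phi x) /\ theta (phi x) = x &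
        forall y, ball (phi x0) delta y -> [/\ V (theta y), phi (theta y) = y &
          forall X Y, bilin (g (theta y)) ('D_X theta y) ('D_Y theta y) =
            bilin (g x0) X Y]].
Proof.
move=> oD D0 sg gsym gunit flat.
have [r /= r0 rD] : exists2 r : R, 0 < r & ball x0 r `<=` D.
  by apply/nbhs_ballP; exact: open_nbhs_nbhs.
have [rho [P [Q [/andP[rho0 rhor] sP sQ [P0 Q0] HPQ]]]] :=
  @pfaff R N x0 N r (christoffel_mx g) r0
    (fun i => smooth_sub rD (christoffel_mx_smooth oD sg gunit i))
    (fun x bx i j => christoffel_mx_integrable oD sg gunit i j (rD _ bx) flat).
have rhoD : ball x0 rho `<=` D by move=> x bx; apply: rD; exact: ballW bx.
have oB : open (ball x0 rho) by exact: ball_open.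
pose a j x := row j (P x).
have sa j : smooth_on (ball x0 rho) (a j).
  apply: (smooth_mxP _ oB).2 => u k.
  have -> : (fun y => a j y u k) = (fun y => P y j k).
    by apply/funext => y; rewrite mxE.
  exact: (smooth_mxP _ oB).1.
have da i j x : ball x0 rho x -> pd i (a j) x = row j (christoffel_mx g i x *m P x).
  move=> bx; have [_ dP _] := HPQ x bx; apply/rowP => k.
  rewrite pd_mxE; last exact: smooth_derivable (sa j) bx.
  have -> : (fun y => a j y 0 k) = (fun y => P y j k).
    by apply/funext => y; rewrite mxE.
  rewrite -pd_mxE; last exact: smooth_derivable sP bx.
  by rewrite /pd (is_deriveE (dP i)) [RHS]mxE.
have [phi [sphi dphi]] : exists phi, smooth_on (ball x0 rho) phi /\
    forall x, ball x0 rho x -> forall i, pd i phi x = a i x.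
  apply: poincare_rV => // x bx i j; rewrite !da//; apply/rowP => k.
  rewrite !mxE; apply: eq_bigr => m _; rewrite !mxE; congr (_ * _).
  exact: christoffel_sym oD sg gsym _ _ _ _ (rhoD _ bx).
have [delta [V [theta [delta0 [oV V0] Vsub HV [sth Hth]]]]] :
  exists (delta : R) (V : set 'rV[R]_N) (theta : 'rV[R]_N -> 'rV[R]_N),
    [/\ 0 < delta, open V /\ V x0, V `<=` ball x0 rho,
        forall x, V x -> ball (phi x0) delta (phi x) /\ theta (phi x) = x &
        smooth_on (ball (phi x0) delta) theta /\
        forall y, ball (phi x0) delta y -> [/\ V (theta y), phi (theta y) = y &
          forall v, is_derive y v theta (v *m Q (theta y))]].
  apply: (inverse_function (P := P)) => // x bx; have [QP _ _] := HPQ x bx.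
  by split=> // i; exact: dphi.
have Qconst x : ball x0 rho x -> Q x *m g x *m (Q x)^T = g x0.
  move=> bx; rewrite -[RHS]mul1mx -[RHS]mulmx1 -{1}Q0 -trmx1 -Q0.
  apply: (pd0_const_mx rho0 (F := fun x => Q x *m g x *m (Q x)^T)) bx => z bz i.
  have [_ _ /(_ i) dQ] := HPQ z bz.
  have dg : is_derive z (ebase i) g (pd i g z) by exact: smooth_is_derive sg (rhoD _ bz).
  have := is_derive_mulmx (is_derive_mulmx dQ dg) (is_derive_trmx dQ).
  rewrite (metric_compat oD sg gsym gunit i (rhoD _ bz)).
  rewrite linearN/= trmx_mul mulmxN mulNmx mulmxDr !mulmxA.
  rewrite addrA addNr add0r subrr.
  exact.
exists delta, V, phi, theta; split=> //.
- by split=> // x /Vsub/rhoD.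
- by split=> //; exact: smooth_sub sphi.
- move=> y yb; have [Vt E dth] := Hth y yb; split=> // X Y.
  rewrite (is_deriveE (dth X)) (is_deriveE (dth Y)) /bilin trmx_mul.
  by rewrite -(Qconst _ (Vsub _ Vt)) !mulmxA.
Qed.

Lemma bilin_inj n (A B : 'M[R]_n) :
  (forall X Y, bilin A X Y = bilin B X Y) -> A = B.
Proof. by move=> H; apply/matrixP => i j; rewrite -!bilin_ebase. Qed.

Lemma flat_chart (M : frobeniusManifold R N) (p : M) :
  exists (b : chart R N M) (delta : R) (eta : 'M[R]_N),
    [/\ atlas b, chart_dom b p, 0 < delta,
        chart_cod b = ball (chart_map b p) delta &
        forall y, chart_cod b y -> fmetric b y = eta].
Proof.
have [a Aa ap] := atlas_cover p.
have F := fmanifoldP Aa.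
have [delta [V [phi [theta [delta0 [oV V0 Vsub] [sphi sth] HV Hth]]]]] :=
  flat_coordinates (@chart_cod_open _ _ _ a) (chart_map_in ap) (fr_metric_smooth F)
    (fr_metric_sym F) (fr_metric_nondegenerate F) (fr_flat F).
set y0 := phi (chart_map a p) in Hth HV sth.
have oW : open (ball y0 delta) by exact: ball_open.
have HW y : ball y0 delta y -> V (theta y) /\ phi (theta y) = y.
  by move=> /Hth[].
have [b [Ab cb db mb ib]] := chart_diffeo Aa oV oW Vsub HV HW sphi sth.
exists b, delta, (fmetric a (chart_map a p)); split=> //.
- by rewrite db.
- by rewrite cb mb.
rewrite cb => y yb; apply: bilin_inj => X Y.
have [Vt E Hb] := Hth y yb.
have tE z : ball y0 delta z -> transition b a z = theta z.
  by move=> zb; rewrite /transition ib/= chart_invK//; apply: Vsub; case: (Hth z zb).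
have ov : overlap b a y.
  by split; rewrite ?cb//= ib/=; apply: chart_inv_in; exact: Vsub.
rewrite (fmetric_tensor Ab Aa ov) tE// -Hb.
have ch Z : change_chart b a y Z = 'D_Z theta y.
  by apply: near_eq_derive; exact: (open_near oW yb tE).
by rewrite !ch.
Qed.

Lemma chart_restrict (M : frobeniusManifold R N) (b : chart R N M) (y0 : 'rV[R]_N) (rho : R) :
  atlas b -> ball y0 rho `<=` chart_cod b ->
  exists b' : chart R N M, [/\ atlas b', chart_cod b' = ball y0 rho,
    chart_dom b' = [set p | chart_dom b p /\ ball y0 rho (chart_map b p)],
    forall y, ball y0 rho y -> fmetric b' y = fmetric b y &
    forall y, ball y0 rho y -> forall X Y, fmul b' y X Y = fmul b y X Y].
Proof.
move=> Ab sub; have oB : open (ball y0 rho) by exact: ball_open.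
have sid : smooth_on (ball y0 rho) (@id 'rV[R]_N).
  apply: (smooth_mxP _ oB).2 => i k; rewrite (ord1 i).
  by apply/smooth_onP => n; exact: Cn_coord.
have Hid y : ball y0 rho y -> ball y0 rho (id y) /\ id (id y) = y by [].
have [b' [Ab' cb db mb ib]] := chart_diffeo Ab oB oB sub Hid Hid sid sid.
have tE z : ball y0 rho z -> transition b' b z = id z.
  by move=> zb; rewrite /transition ib/= chart_invK//; exact: sub.
have ov y : ball y0 rho y -> overlap b' b y.
  by move=> yb; split; [rewrite cb|rewrite ib/=; apply: chart_inv_in; exact: sub].
have ch y Z : ball y0 rho y -> change_chart b' b y Z = Z.
  move=> yb; rewrite -[RHS](derive_id y Z).
  by apply: near_eq_derive; exact: (open_near oB yb tE).
exists b'; split=> // y yb.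
  by apply: bilin_inj => X Y; rewrite (fmetric_tensor Ab' Ab (ov y yb)) tE// !ch.
by move=> X Y; have := fmul_tensor Ab' Ab (ov y yb) X Y; rewrite tE// !ch.
Qed.

End FlatCoordinates.

(** * Frobenius structures with constant metric *)

Section ConstantMetric.
Context {R : realType} {N : nat} (D : set 'rV[R]_N) (g : 'rV[R]_N -> 'M[R]_N).
Variable eta : 'M[R]_N.
Hypotheses (oD : open D) (gc : forall x, D x -> g x = eta).

Lemma pd_const_metric k x : D x -> pd k g x = 0.
Proof. by move=> Dx; rewrite (pd_eq k oD gc Dx) pd_cst. Qed.

Lemma christoffel_const k i j x : D x -> christoffel g k i j x = 0.
Proof.
move=> Dx; rewrite /christoffel big1 ?mulr0// => l _.
by rewrite !pd_const_metric// !mxE subr0 addr0 mulr0.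
Qed.

Lemma flat_const : flat_metric D g.
Proof.
move=> x Dx l k i j; rewrite /riemann.
have H a b c d : pd d (christoffel g a b c) x = 0.
  rewrite (pd_eq d oD (g := fun=> 0) _ Dx) ?pd_cst// => y Dy.
  exact: christoffel_const.
rewrite (H l j k i) (H l i k j) subrr add0r big1// => m _.
by rewrite (christoffel_const l i m Dx) (christoffel_const l j m Dx) !mul0r subrr.
Qed.

Lemma nabla_cov3_const t i j k l x : D x -> nabla_cov3 g t i j k l x = pd i (t j k l) x.
Proof.
move=> Dx; rewrite /nabla_cov3.
by rewrite !big1 ?subr0// => m _; rewrite christoffel_const// mul0r.
Qed.

Lemma third_cov_deriv_const f i j k x : D x ->
  third_cov_deriv g f i j k x = pd i (pd j (pd k f)) x.
Proof.
move=> Dx; rewrite /third_cov_deriv /nabla_cov2.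
rewrite !big1 ?subr0; try by move=> m _; rewrite christoffel_const// mul0r.
apply: pd_eq (Dx) => // y Dy; rewrite /nabla_cov1.
by rewrite big1 ?subr0// => m _; rewrite christoffel_const// mul0r.
Qed.

End ConstantMetric.

Section FlatFrobenius.
Context {R : realType} {N : nat} (D : set 'rV[R]_N) (g : 'rV[R]_N -> 'M[R]_N).
Context (mul : 'rV[R]_N -> 'rV[R]_N -> 'rV[R]_N -> 'rV[R]_N).
Context (U E : 'rV[R]_N -> 'rV[R]_N) (K : R) (eta : 'M[R]_N).
Hypotheses (oD : open D) (F : frobenius_on D g mul U E K).
Hypothesis gc : forall x, D x -> g x = eta.

Definition mult i x : 'M[R]_N := \matrix_(j, k) mul x (ebase i) (ebase j) 0 k.

Lemma mult_smooth i : smooth_on D (mult i).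
Proof.
apply: (smooth_mxP _ oD).2 => j k.
have -> : (fun y => mult i y j k) = (fun y => mul y (ebase i) (ebase j) 0 k).
  by apply/funext => y; rewrite mxE.
exact: ((smooth_mxP _ oD).1 (fr_mul_smooth F i j)).
Qed.

Lemma mulmx_mult i x v : D x -> v *m mult i x = mul x (ebase i) v.
Proof.
move=> Dx; have lin : linear (mul x (ebase i)).
  by move=> c Y Z; exact: (fr_mul_linearr F Dx).
pose L : {linear 'rV[R]_N -> 'rV[R]_N} :=
  HB.pack (mul x (ebase i)) (GRing.isLinear.Build _ _ _ _ _ lin).
rewrite -[mul x _ v]/(L v) {2}(ebase_sum v) linear_sum mulmx_sum_row.
apply: eq_bigr => j _; rewrite linearZ/=; congr (_ *: _).
by apply/rowP => k; rewrite !mxE.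
Qed.

Lemma mult_sym i j k x : D x -> mult i x j k = mult j x i k.
Proof. by move=> Dx; rewrite !mxE (fr_mulC F Dx). Qed.

Lemma mult_comm i j x : D x -> mult i x *m mult j x = mult j x *m mult i x.
Proof.
move=> Dx; apply/row_matrixP => k; rewrite !rowE !mulmxA !mulmx_mult//.
rewrite -!(fr_mulA F Dx) ![mul x _ (ebase k)](fr_mulC F Dx).
by rewrite (fr_mulC F Dx (ebase j) (ebase i)).
Qed.

Lemma eta_sym x : D x -> eta^T = eta.
Proof. by move=> Dx; rewrite -(gc Dx) (fr_metric_sym F). Qed.

Lemma eta_unit x : D x -> eta \in unitmx.
Proof. by move=> Dx; rewrite -(gc Dx) (fr_metric_nondegenerate F). Qed.

Lemma A_tensorE i j k x : D x -> A_tensor g mul i j k x = (mult i x *m eta) j k.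
Proof.
move=> Dx; rewrite /A_tensor gc// /bilin -mulmx_mult// /ebase trmx_delta -colE.
by rewrite mxE -rowE -row_mul mxE.
Qed.

Lemma bilin_sym n (Q : 'M[R]_n) v w : Q^T = Q -> bilin Q v w = bilin Q w v.
Proof.
by move=> Qs; rewrite /bilin -[in LHS](trmxK (v *m Q *m w^T)) mxE !trmx_mul trmxK Qs mulmxA.
Qed.

Lemma mult_eta_sym i x : D x -> (mult i x *m eta)^T = mult i x *m eta.
Proof.
move=> Dx; apply/matrixP => k j; rewrite mxE -!A_tensorE// /A_tensor.
rewrite (fr_mulC F Dx) (fr_mul_invariant F Dx).
by rewrite bilin_sym// (fr_metric_sym F).
Qed.

Lemma mult_closed i j x : D x -> pd i (mult j) x = pd j (mult i) x.
Proof.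
move=> Dx.
have key a b : pd a (mult b) x *m eta = \matrix_(c, d) pd a (A_tensor g mul b c d) x.
  have Dm : is_derive x (ebase a) (fun y => mult b y *m eta) (pd a (mult b) x *m eta).
    have := is_derive_mulmx (smooth_is_derive a (mult_smooth b) Dx)
      (is_derive_cst eta x (ebase a)).
    by rewrite mulmx0 addr0.
  rewrite -[LHS](is_deriveE Dm) -/(pd a _ x); apply/matrixP => c d.
  rewrite pd_mxE; last exact: is_derivable Dm.
  rewrite [RHS]mxE; apply: pd_eq (Dx) => // y Dy.
  by rewrite A_tensorE.
have H : pd i (mult j) x *m eta = pd j (mult i) x *m eta.
  rewrite !key; apply/matrixP => c d; rewrite !mxE.
  have [S _ _] := fr_nablaA_sym F Dx i j c d.
  have e1 := nabla_cov3_const oD gc (A_tensor g mul) i j c d Dx.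
  have e2 := nabla_cov3_const oD gc (A_tensor g mul) j i c d Dx.
  exact: etrans (esym e1) (etrans S e2).
have eK (A : 'M[R]_N) : A = A *m eta *m invmx eta by rewrite mulmxK// (eta_unit Dx).
exact: etrans (eK _) (etrans (congr1 (fun Z => Z *m invmx eta) H) (esym (eK _))).
Qed.

End FlatFrobenius.

Section Realization.
Context {R : realType} {N : nat} (y0 : 'rV[R]_N) (delta : R).
Context (g : 'rV[R]_N -> 'M[R]_N).
Context (mul : 'rV[R]_N -> 'rV[R]_N -> 'rV[R]_N -> 'rV[R]_N).
Context (U E : 'rV[R]_N -> 'rV[R]_N) (K : R) (eta : 'M[R]_N).
Hypothesis delta0 : 0 < delta.
Let D := ball y0 delta.
Hypothesis F : frobenius_on D g mul U E K.
Hypothesis gc : forall x, D x -> g x = eta.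

Let oD : open D. Proof. exact: ball_open. Qed.
Let D0 : D y0. Proof. exact: ballxx. Qed.
Let C i x := mult mul i x.
Let sC i : smooth_on D (C i). Proof. exact: (mult_smooth oD F). Qed.
Let etaS : eta^T = eta. Proof. exact: eta_sym F gc _ D0. Qed.
Let etaU : eta \in unitmx. Proof. exact: eta_unit F gc _ D0. Qed.
Let closedC i j x : D x -> pd i (C j) x = pd j (C i) x.
Proof. exact: (mult_closed oD F gc). Qed.

Lemma potential_exists : exists Phi : 'rV[R]_N -> R, smooth_on D Phi /\
  forall x, D x -> forall i j k, pd i (pd j (pd k Phi)) x = (C i x *m eta) j k.
Proof.
pose S i j k x := (C i x *m eta) j k.
have dCe i l x : D x -> is_derive x (ebase l) (fun y => C i y *m eta) (pd l (C i) x *m eta).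
  move=> Dx; have := is_derive_mulmx (smooth_is_derive l (sC i) Dx) (is_derive_cst eta x (ebase l)).
  by rewrite mulmx0 addr0.
have sS i j k : smooth_on D (S i j k).
  apply: ((smooth_mxP _ oD).1); apply: smooth_mulmx => //; exact: smooth_cst.
have dS l i j k x : D x -> pd l (S i j k) x = (pd l (C i) x *m eta) j k.
  move=> Dx; rewrite -pd_mxE; last exact: is_derivable (dCe i l x Dx).
  by rewrite /pd (is_deriveE (dCe i l x Dx)).
have Sij i j k x : D x -> S i j k x = S j i k x.
  by move=> Dx; rewrite /S !mxE; apply: eq_bigr => m _; rewrite /C (mult_sym F)//.
have Sjk i j k x : D x -> S i j k x = S i k j x.
  by move=> Dx; rewrite /S -[in LHS](mult_eta_sym F gc i Dx) mxE.
have Sli l i j k x : D x -> pd l (S i j k) x = pd i (S l j k) x.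
  by move=> Dx; rewrite (dS l i j k x Dx) (dS i l j k x Dx) closedC.
have /choice[h Hh] : forall jk : 'I_N * 'I_N, exists h, [/\ smooth_on D h, h y0 = 0 &
    forall x, D x -> forall i, pd i h x = S i jk.1 jk.2 x].
  move=> [j k]; apply: (poincare (a := fun i => S i j k)) => //.
  by move=> x Dx i l; exact: Sli.
have hsym j k x : D x -> h (j, k) x = h (k, j) x.
  move=> Dx; have [s1 z1 d1] := Hh (j, k); have [s2 z2 d2] := Hh (k, j).
  apply/eqP; rewrite -subr_eq0; apply/eqP.
  have -> : 0 = h (j, k) y0 - h (k, j) y0 by rewrite z1 z2 subrr.
  apply: (pd0_const delta0 (f := fun x => h (j, k) x - h (k, j) x)) Dx => z Dz i.
  have D1 := smooth_is_derive i s1 Dz; have D2 := smooth_is_derive i s2 Dz.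
  have D3 := is_deriveB D1 D2.
  split; first exact: is_derivable D3.
  by rewrite [LHS](is_deriveE D3) d1// d2//= Sjk// subrr.
have /choice[f Hf] : forall k, exists f, [/\ smooth_on D f, f y0 = 0 &
    forall x, D x -> forall j, pd j f x = h (j, k) x].
  move=> k; apply: (poincare (a := fun j => h (j, k))) => //.
    by move=> j; case: (Hh (j, k)).
  move=> x Dx i j; have [_ _ d1] := Hh (j, k); have [_ _ d2] := Hh (i, k).
  by rewrite d1// d2//= Sij.
have [Phi [sPhi _ dPhi]] : exists Phi, [/\ smooth_on D Phi, Phi y0 = 0 &
    forall x, D x -> forall k, pd k Phi x = f k x].
  apply: (poincare (a := f)) => //.
    by move=> k; case: (Hf k).
  move=> x Dx i j; have [_ _ d1] := Hf j; have [_ _ d2] := Hf i.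
  by rewrite d1// d2//; exact: hsym.
exists Phi; split=> // x Dx i j k.
have [_ _ d1] := Hf k; have [_ _ d2] := Hh (j, k).
rewrite -[RHS]/(S i j k x) -(d2 x Dx i).
apply: pd_eq (Dx) => // y Dy; rewrite -d1//.
by apply: pd_eq (Dy) => // z Dz; exact: dPhi.
Qed.

(* Gauss and Weingarten equations d_i r_j = - c_ij^b n_b, d_i n_a = - c_ia^b r_b
   for the frame made of the r_j = d_j r and the normals n_a, when the normals
   have Gram matrix - eta. *)
Let B i x : 'M[R]_(N + N) := - block_mx 0 (C i x) (C i x) 0.
Let G0 : 'M[R]_(N + N) := block_mx eta 0 0 (- eta).

Let blockE (A : 'M[R]_N) : block_mx 0 A A 0 =
  col_mx 1%:M 0 *m A *m row_mx 0 1%:M + col_mx 0 1%:M *m A *m row_mx 1%:M 0.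
Proof.
rewrite !mul_col_mx !mul0mx !mul1mx !mul_mx_row !mulmx0 !mulmx1.
by rewrite add_col_mx addr0 add0r.
Qed.

Let is_derive_block (A : 'rV[R]_N -> 'M[R]_N) x i dA :
  is_derive x (ebase i) A dA ->
  is_derive x (ebase i) (fun y => - block_mx 0 (A y) (A y) 0) (- block_mx 0 dA dA 0).
Proof.
move=> H.
have c m n (X : 'M[R]_(m, n)) := is_derive_cst X x (ebase i).
have T m n (X : 'M[R]_(m, N)) (Y : 'M[R]_(N, n)) :
    is_derive x (ebase i) (fun y => X *m A y *m Y) (X *m dA *m Y).
  have := is_derive_mulmx (is_derive_mulmx (c _ _ X) H) (c _ _ Y).
  by rewrite mul0mx add0r mulmx0 addr0.
rewrite blockE; under [X in is_derive _ _ X]eq_fun do rewrite blockE.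
exact: is_derive_opp (is_deriveD (T _ _ _ _) (T _ _ _ _)).
Qed.

Let sB i : smooth_on D (B i).
Proof.
apply: smooth_opp => //.
have T m n (X : 'M[R]_(m, N)) (Y : 'M[R]_(N, n)) :
    smooth_on D (fun y => X *m C i y *m Y).
  apply: smooth_mulmx => //; last exact: smooth_cst.
  by apply: smooth_mulmx => //; exact: smooth_cst.
under eq_fun do rewrite blockE.
by apply: smoothD.
Qed.

Let intB x : D x -> forall i j,
  pd i (B j) x - pd j (B i) x = B i x *m B j x - B j x *m B i x.
Proof.
move=> Dx i j.
have dB a b : pd a (B b) x = - block_mx 0 (pd a (C b) x) (pd a (C b) x) 0.
  exact: is_deriveE (is_derive_block (smooth_is_derive a (sC b) Dx)).
rewrite !dB closedC// subrr /B !mulNmx !mulmxN !opprK !mulmx_block.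
by rewrite !mul0mx !mulmx0 !addr0 !add0r /C (mult_comm F)// subrr.
Qed.

Let BG0 i x : D x -> B i x *m G0 + G0 *m (B i x)^T = 0.
Proof.
move=> Dx; rewrite /B /G0 linearN/= tr_block_mx !trmx0 mulNmx mulmxN !mulmx_block.
rewrite !mul0mx !mulmx0 !addr0 !add0r.
have H : eta *m (C i x)^T = C i x *m eta.
  by rewrite -[RHS](mult_eta_sym F gc i Dx) trmx_mul etaS.
by rewrite mulNmx mulmxN H -opprD add_block_mx !addr0 addNr subrr block_mx0 oppr0.
Qed.

Let bilinG0 (u1 u2 v1 v2 : 'rV[R]_N) :
  bilin G0 (row_mx u1 u2) (row_mx v1 v2) = bilin eta u1 v1 - bilin eta u2 v2.
Proof.
rewrite /bilin /G0 mul_row_block tr_row_mx mul_row_col !mulmx0 addr0 add0r.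
by rewrite mulmxN mulNmx !mxE.
Qed.

Lemma embedding_lipschitz p (A : set 'rV[R]_N) (r : 'rV[R]_N -> 'rV[R]_p) (c : R) :
  (forall x y, A x -> A y -> `|y - x| <= c * `|r y - r x|) -> embedding A r.
Proof.
move=> H.
have /choice[q Hq] : forall z, exists x, (exists2 x', A x' & r x' = z) -> A x /\ r x = z.
  move=> z; have [[x Ax <-]|n] := pselect (exists2 x', A x' & r x' = z).
    by exists x.
  by exists 0.
have qr x : A x -> q (r x) = x.
  move=> Ax; have [Aq E1] : A (q (r x)) /\ r (q (r x)) = r x by apply: Hq; exists x.
  by have := H _ _ Ax Aq; rewrite E1 subrr normr0 mulr0 normr_le0 subr_eq0 => /eqP.
exists q; split=> //; apply/subspace_continuousP => _ [x Ax <-].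
suff qcvg : q z @[z --> within (r @` A) (nbhs (r x))] --> x.
  exact: (eq_ind x (fun l => q z @[z --> within (r @` A) (nbhs (r x))] --> l) qcvg _
    (esym (qr x Ax))).
apply/cvgrPdist_le => e e0.
have c0 : 0 < `|c| + 1 by rewrite ltr_wpDl.
have H1 : \forall z \near r x, `|r x - z| < e / (`|c| + 1).
  by apply: (@cvgr_dist_lt _ _ _ (nbhs (r x)) _ id) => //; rewrite divr_gt0.
rewrite near_withinE; apply: filterS H1 => z zx [y Ay rz].
rewrite -{}rz in zx *; rewrite qr// distrC.
apply: (le_trans (H _ _ Ax Ay)); apply: (@le_trans _ _ ((`|c| + 1) * `|r y - r x|)).
  by rewrite ler_wpM2r// (le_trans (ler_norm c))// lerDl.
by rewrite mulrC -ler_pdivlMr// ltW// distrC.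
Qed.

Lemma realization d : (N + N)%N = d ->
  exists (rho : R) (Q : 'M[R]_d) (r : 'rV[R]_N -> 'rV[R]_d) (n : 'I_N -> 'rV[R]_N -> 'rV[R]_d),
    [/\ 0 < rho <= delta, pseudo_euclidean Q,
        smooth_on (ball y0 rho) r /\ embedding (ball y0 rho) r,
        torsionless_frame (ball y0 rho) Q r n &
        forall x, ball y0 rho x -> first_form Q r x = eta /\
          forall i j k, second_form Q r n i j k x = (C i x *m eta) j k].
Proof.
case: d /.
have [rho [P [P' [/andP[rho0 rhod] sP sP' [P0 P'0] HP]]]] := pfaff delta0 sB intB.
have sub : ball y0 rho `<=` D by exact: ballW.
have oB : open (ball y0 rho) by exact: ball_open.
have gram x : ball y0 rho x -> P x *m G0 *m (P x)^T = G0.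
  move=> bx; have [P'P _ _] := HP x bx.
  have PP' : P x *m P' x = 1%:M by exact: mulmx1C.
  have H : P' x *m G0 *m (P' x)^T = G0.
    rewrite -[RHS]mul1mx -[RHS]mulmx1 -{1}P'0 -trmx1 -P'0.
    apply: (pd0_const_mx rho0 (F := fun x => P' x *m G0 *m (P' x)^T)) bx => z bz i.
    have [_ _ /(_ i) dP'] := HP z bz.
    have := is_derive_mulmx (is_derive_mulmx dP' (is_derive_cst G0 z (ebase i))) (is_derive_trmx dP').
    have alg (X Y G : 'M[R]_(N + N)) : (- (X *m Y) *m G + X *m 0) *m X^T +
        X *m G *m (- (X *m Y))^T = - (X *m (Y *m G + G *m Y^T) *m X^T).
      have -> : (- (X *m Y))^T = - (Y^T *m X^T) by rewrite linearN/= trmx_mul.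
      rewrite mulmx0 addr0 mulmxN !mulNmx mulmxDr mulmxDl opprD.
      by rewrite !mulmxA.
    rewrite (alg (P' z) (B i z) G0).
    by rewrite BG0 ?mulmx0 ?mul0mx ?oppr0//; exact: sub.
  rewrite -[in LHS]H !mulmxA PP' mul1mx -mulmxA -trmx_mul PP' trmx1 mulmx1.
  by [].
have bilinP x u v : ball y0 rho x -> bilin G0 (u *m P x) (v *m P x) = bilin G0 u v.
  by move=> bx; rewrite /bilin trmx_mul -[in RHS](gram x bx) !mulmxA.
pose a i x := row_mx (ebase i) 0 *m P x : 'rV[R]_(N + N).
pose n i x := row_mx 0 (ebase i) *m P x : 'rV[R]_(N + N).
have dconst (u : 'rV[R]_(N + N)) x i : ball y0 rho x ->
    is_derive x (ebase i) (fun y => u *m P y) (u *m B i x *m P x).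
  move=> bx; have [_ dP _] := HP x bx.
  have := is_derive_mulmx (is_derive_cst u x (ebase i)) (dP i).
  by rewrite mul0mx add0r mulmxA.
have smoothu (u : 'rV[R]_(N + N)) : smooth_on (ball y0 rho) (fun y => u *m P y).
  by apply: smooth_mulmx => //; exact: smooth_cst.
have rB (u v : 'rV[R]_N) i x : row_mx u v *m B i x = - row_mx (v *m C i x) (u *m C i x).
  by rewrite /B mulmxN mul_row_block !mulmx0 addr0 add0r.
have daE x i j : ball y0 rho x -> pd i (a j) x = row_mx 0 (- (ebase j *m C i x)) *m P x.
  move=> bx; rewrite /pd (is_deriveE (dconst _ x i bx)) rB mul0mx.
  by rewrite opp_row_mx oppr0.
have dnE x i j : ball y0 rho x -> pd i (n j) x = row_mx (- (ebase j *m C i x)) 0 *m P x.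
  move=> bx; rewrite /pd (is_deriveE (dconst _ x i bx)) rB mul0mx.
  by rewrite opp_row_mx oppr0.
have eC i j x : ball y0 rho x -> ebase j *m C i x = ebase i *m C j x.
  move=> /sub Dx; rewrite /C (mulmx_mult F i (ebase j) Dx) (mulmx_mult F j (ebase i) Dx).
  exact: (fr_mulC F Dx).
have [r [sr dr]] : exists r, smooth_on (ball y0 rho) r /\
    forall x, ball y0 rho x -> forall i, pd i r x = a i x.
  apply: (poincare_rV (a := a)) => [//|i|x bx i j]; first exact: smoothu.
  apply: etrans (daE x i j bx) (etrans _ (esym (daE x j i bx))).
  exact: (congr1 (fun w => row_mx 0 (- w) *m P x) (eC i j x bx)).
have ddr x i j : ball y0 rho x -> pd i (pd j r) x = row_mx 0 (- (ebase j *m C i x)) *m P x.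
  by move=> bx; rewrite -daE//; apply: pd_eq bx => // y yb; exact: dr.
pose psi x : 'rV[R]_N := lsubmx (r x).
have psiE x k : psi x 0 k = r x 0 (lshift N k) by rewrite mxE.
have Cpsi : Cn 1 (ball y0 rho) psi.
  apply: (Cn_mxP _ _ oB).2 => i k; rewrite (ord1 i).
  have -> : (fun x => psi x 0 k) = (fun x => r x 0 (lshift N k)).
    by apply/funext => x; exact: psiE.
  exact: ((Cn_mxP _ _ oB).1 ((smooth_onP _ _).1 sr 1)).
have b0 : ball y0 rho y0 by exact: ballxx.
have dpsi i : pd i psi y0 = ebase i.
  apply/rowP => k; rewrite pd_mxE; last exact: Cn_derivable Cpsi b0.
  have -> : (fun x => psi x 0 k) = (fun x => r x 0 (lshift N k)).
    by apply/funext => x; exact: psiE.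
  rewrite -pd_mxE; last exact: smooth_derivable sr b0.
  by rewrite dr// /a P0 mulmx1 row_mxEl.
have [rho' /andP[rho'0 rho'r] Hpsi] := near_identity rho0 Cpsi dpsi.
have sub' : ball y0 rho' `<=` ball y0 rho by exact: ballW (ltW rho'r).
have bilin0l w : bilin eta 0 w = 0 by rewrite /bilin !mul0mx mxE.
have bilin0r w : bilin eta w 0 = 0 by rewrite /bilin trmx0 mulmx0 mxE.
have first x : ball y0 rho' x -> first_form G0 r x = eta.
  move=> /sub' bx; apply/matrixP => i j.
  by rewrite mxE !dr// bilinP// bilinG0 bilin0l subr0 bilin_ebase.
exists rho', G0, r, n; split.
- by rewrite rho'0 (le_trans (ltW rho'r)).
- split; first by rewrite /G0 tr_block_mx !trmx0 linearN/= etaS.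
  apply: (@mulmx1_unit _ _ _ (block_mx (invmx eta) 0 0 (- invmx eta)) _).1.
  rewrite /G0 mulmx_block !mul0mx !mulmx0 !addr0 !add0r mulmxN mulNmx opprK.
  by rewrite mulmxV// -scalar_mx_block.
- split; first exact: smooth_sub sr.
  apply: (@embedding_lipschitz _ _ _ 2) => x y bx yb.
  apply: (le_trans (near_identity_inj Hpsi bx yb)); rewrite ler_wpM2l//.
  apply: norm_le_entries => // i k; rewrite (ord1 i).
  have -> : (psi y - psi x) 0 k = (r y - r x) 0 (lshift N k) by rewrite !mxE.
  exact: entry_le_norm.
- split.
  + by move=> i; apply: smooth_sub (smoothu _).
  + move=> x /sub' bx i j.
    by rewrite dr// bilinP// bilinG0 bilin0l bilin0r subrr.
  + exists (- eta).
      by rewrite -scaleN1r unitmxZ ?unitrN1.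
    move=> x /sub' bx i j.
    by rewrite bilinP// bilinG0 bilin0l sub0r bilin_ebase [RHS]mxE.
  + move=> x /sub' bx i j k.
    by rewrite dnE// bilinP// bilinG0 bilin0l bilin0r subrr.
move=> x bx; split; first exact: first.
move=> i j k; have bx' := sub' _ bx; have Dx := sub _ bx'.
rewrite /second_form ddr// bilinP// bilinG0 bilin0l sub0r.
have -> : - bilin eta (ebase i) (- (ebase k *m C j x)) = bilin eta (ebase k *m C j x) (ebase i).
  by rewrite bilin_sym// /bilin !mulNmx mxE opprK.
rewrite -[LHS]/((ebase k *m C j x *m eta *m (ebase i)^T) 0 0).
rewrite -[_ *m C j x *m eta]mulmxA -[LHS]/(bilin (C j x *m eta) (ebase k) (ebase i)) bilin_ebase.
rewrite -[in LHS](mult_eta_sym F gc j Dx) mxE.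
by rewrite !mxE; apply: eq_bigr => m _; rewrite /C (mult_sym F).
Qed.

End Realization.

Theorem theorem6p4 (R : realType) (N : nat) (M : frobeniusManifold R N) (p : M) :
  exists a : chart R N M, [/\ atlas a, chart_dom a p &
    exists (Q : 'M[R]_(2 * N)) (r : 'rV[R]_N -> 'rV[R]_(2 * N))
           (n : 'I_N -> 'rV[R]_N -> 'rV[R]_(2 * N)),
    [/\ pseudo_euclidean Q,
        potential_submanifold (chart_cod a) Q r n,
        (forall x, chart_cod a x -> fmetric a x = first_form Q r x) &
        (forall x, chart_cod a x -> forall i j : 'I_N,
           fmul a x (ebase i) (ebase j) =
           \sum_k (\sum_s invmx (first_form Q r x) k s * second_form Q r n i s j x)
                    *: ebase k)]].
Proof.
have [b [delta [eta [Ab bp delta0 cb gc]]]] := flat_chart p.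
have F := fmanifoldP Ab; rewrite cb in F gc.
set y0 := chart_map b p in cb F gc.
have e : (N + N = 2 * N)%N by rewrite mul2n addnn.
have [rho [Q [r [n [/andP[rho0 rhod] pQ sr tf HH]]]]] := realization delta0 F gc e.
have [Phi [sPhi dPhi]] := potential_exists delta0 F gc.
have sub : ball y0 rho `<=` ball y0 delta by exact: ballW.
have subb : ball y0 rho `<=` chart_cod b by rewrite cb.
have [b' [Ab' cb' db' gb' mb']] := chart_restrict Ab subb.
have oB : open (ball y0 rho) by exact: ball_open.
have D0 : ball y0 delta y0 by exact: ballxx.
have etaU : eta \in unitmx := eta_unit F gc D0.
have fc x : ball y0 rho x -> first_form Q r x = eta by move=> /HH[].
exists b'; split=> //; first by rewrite db'; split=> //; exact: ballxx.
exists Q, r, n; split=> //; rewrite cb'.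
- split; first split=> //.
  + by move=> x bx; rewrite fc.
  + exact: flat_const fc.
  move=> x bx; exists (ball y0 rho), Phi; split=> //; first exact: smooth_sub sPhi.
  move=> y yb i j k; rewrite (third_cov_deriv_const oB fc)//.
  by rewrite (HH y yb).2 (dPhi y (sub _ yb)).
- by move=> x bx; rewrite gb'// gc ?fc//; exact: sub.
- move=> x bx i j; rewrite mb'// fc//.
  rewrite [LHS]ebase_sum; apply: eq_bigr => k _; congr (_ *: _).
  under eq_bigr do rewrite (HH x bx).2.
  have Dx := sub _ bx.
  have := congr1 (mulmx (invmx eta)) (mult_eta_sym F gc i Dx).
  rewrite trmx_mul (eta_sym F gc Dx) mulmxA mulVmx// mul1mx.
  by move=> /(congr1 (fun A : 'M_N => A k j)); rewrite !mxE.
Qed.
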